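(* Let $G=(V,w,m,d)$ be a salami. Then: (i) $G$ has exactly two ends; (ii) $G$ is flat, i.e. $\kappa(x)=0$ for all $x\in V$; (iii) $G$ is recurrent; (iv) there exists a harmonic function $f\in\mathbb{R}^V$ with constant gradient, namely $\Delta f=0$ and $\nabla_-f(x)=\nabla_+f(x)=1$ for all $x\in V$.
   Context: A graph $G=(V,w,m,d)$ consists of a countable set $V$, a symmetric function $w:V\times V\to[0,\infty)$ vanishing on the diagonal, a function $m:V\to(0,\infty)$, and a metric $d:V\times V\to[0,\infty)$. Write $x\sim y$ if $w(x,y)>0$, $E=\{(x,y):w(x,y)>0\}$, $E(X,Y)=E\cap(X\times Y)$, and $m(X)=\sum_{x\in X}m(x)$. The graph is locally finite (every vertex has finitely many neighbours), $d$ is a path metric, i.e. $d(x,y)=\inf\{\sum_{i=1}^n d(x_{i-1},x_i): x=x_0\sim\dots\sim x_n=y\}$, and all balls of $d$ are finite. Laplacian: $\Delta f(x)=\frac1{m(x)}\sum_y w(x,y)(f(y)-f(x))$; $f$ is harmonic if $\Delta f=0$. $Lip(1)=\{f\in\mathbb{R}^V: f(y)-f(x)\le d(x,y)\ \forall x,y\in V\}$. Ollivier curvature for $x\ne y$: $\kappa(x,y)=\frac1{d(x,y)}\inf\{\Delta f(x)-\Delta f(y): f\in Lip(1),\ f(y)-f(x)=d(x,y)\}$; $\kappa(x)=\inf_{y\sim x}\kappa(x,y)$. $G$ has non-negative Ollivier curvature if $\kappa(x,y)\ge0$ for all $x\sim y$. A salami partition of $G$ is a triple $(X,Y,K)$ with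 $V=X\,\dot\cup\,Y\,\dot\cup\,K$ (disjoint union), $K$ finite, $E(X,Y)=\emptyset$, $m(X)=m(Y)=\infty$. A salami is a connected, locally finite graph $G=(V,w,m,d)$, with $V$ countable, $w:V\times V\to[0,\infty)$ symmetric and vanishing on the diagonal, $m:V\to(0,\infty)$, and $d$ a path metric on $V$ all of whose balls are finite, with non-negative Ollivier curvature admitting a salami partition. Ends: $G$ has at least $n$ ends if there is a finite $K\subset V$ such that $V\setminus K$ has at least $n$ infinite connected components (of the induced subgraph); exactly $n$ ends if it has at least $n$ but not at least $n+1$ ends. Recurrence: $G$ is recurrent if for all $\varepsilon>0$ there is a finitely supported $f:V\to\mathbb{R}$ with $\|f\|_\infty=1$ and $-\langle f,\Delta f\rangle<\varepsilon$, where $\langle f,g\rangle=\sum_x f(x)g(x)m(x)$. Gradients: $\nabla_+f(x)=\max_{y\sim x}\frac{f(y)-f(x)}{d(x,y)}$, $\nabla_-f(x)=\max_{y\sim x}\frac{f(x)-f(y)}{d(x,y)}$. *)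

(* Defs.v *)
From HB Require Import structures.
From mathcomp Require Import all_boot all_order all_algebra.
From mathcomp Require Import all_classical all_reals all_analysis.

Set Implicit Arguments.
Unset Strict Implicit.
Unset Printing Implicit Defensive.

Import Order.TTheory GRing.Theory Num.Theory.

Local Open Scope classical_set_scope.
Local Open Scope ring_scope.

Record weighted_graph (R : realType) (V : countType) := WeightedGraph {
  weight : V -> V -> R ;
  mass : V -> R ;
  dist : V -> V -> R ;
  weight_ge0 : forall x y, 0 <= weight x y ;
  weight_sym : forall x y, weight x y = weight y x ;
  weight_diag : forall x, weight x x = 0 ;
  mass_gt0 : forall x, 0 < mass x ;
  dist_ge0 : forall x y, 0 <= dist x y ;
  dist_eq0 : forall x y, dist x y = 0 <-> x = y ;
  dist_sym : forall x y, dist x y = dist y x ;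
  dist_triangle : forall x y z, dist x z <= dist x y + dist y z
}.

Section Definitions.
Context {R : realType} {V : countType}.
Variable G : weighted_graph R V.
Implicit Types (x y : V) (p : seq V) (f g : V -> R) (A K X Y : set V).

Definition adj : rel V := fun x y => 0 < weight G x y.

(* A walk x = x_0 ~ ... ~ x_n = y is represented by x and p = [x_1; ...; x_n];
   the case n = 0 (so x = y) is allowed. *)
Definition walk x p y : Prop := path adj x p /\ last x p = y.

Definition walk_length x p : R := \sum_(l <- pairmap (dist G) x p) l.

Definition connected_graph : Prop := forall x y, exists p, walk x p y.

Definition locally_finite : Prop := forall x, finite_set [set y | adj x y].

(* The infimum is taken in \bar R, where the infimum of the empty set is +oo. *)
Definition path_metric : Prop := forall x y,
  (dist G x y)%:E = ereal_inf [set (walk_length x p)%:E | p in [set p | walk x p y]].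

Definition finite_balls : Prop :=
  forall x (r : R), finite_set [set y | dist G x y <= r].

(* For a locally finite graph the summand has finite support in y. *)
Definition laplacian f : V -> R := fun x =>
  (mass G x)^-1 * \sum_(y \in [set: V]) weight G x y * (f y - f x).

Definition harmonic_function f : Prop := forall x, laplacian f x = 0.

Definition Lip1 : set (V -> R) :=
  [set f | forall x y, f y - f x <= dist G x y].

Definition kappa x y : \bar R :=
  (((dist G x y)^-1)%:E *
   ereal_inf [set (laplacian f x - laplacian f y)%:E |
              f in [set f | Lip1 f /\ (f y - f x = dist G x y)%R]])%E.

Definition vertex_kappa x : \bar R :=
  ereal_inf [set kappa x y | y in [set y | adj y x]].

Definition nonneg_ollivier : Prop :=
  forall x y, adj x y -> (0 <= kappa x y)%E.

Definition flat : Prop := forall x, vertex_kappa x = 0%E.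

Definition set_mass X : \bar R := \esum_(x in X) (mass G x)%:E.

Record salami_partition X Y K : Prop := SalamiPartition {
  salami_cover : X `|` Y `|` K = [set: V] ;
  salami_disjXY : X `&` Y = set0 ;
  salami_disjXK : X `&` K = set0 ;
  salami_disjYK : Y `&` K = set0 ;
  salami_finite : finite_set K ;
  salami_no_edge : forall x y, X x -> Y y -> ~~ adj x y ;
  salami_massX : set_mass X = +oo%E ;
  salami_massY : set_mass Y = +oo%E
}.

Record salami : Prop := Salami {
  salami_connected : connected_graph ;
  salami_locally_finite : locally_finite ;
  salami_path_metric : path_metric ;
  salami_finite_balls : finite_balls ;
  salami_nonneg_ollivier : nonneg_ollivier ;
  salami_has_partition : exists X Y K, salami_partition X Y K
}.

(* For x in A, the connected component of x in the subgraph induced on A. *)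
Definition component A x : set V :=
  [set y | exists2 p, walk x p y & {in p, forall z, A z}].

Definition components A : set (set V) := [set component A x | x in A].

Definition at_least_ends (n : nat) : Prop :=
  exists2 K, finite_set K &
    (`I_n #<= [set C | components (~` K) C /\ infinite_set C])%card.

Definition exactly_ends (n : nat) : Prop :=
  at_least_ends n /\ ~ at_least_ends n.+1.

Definition finitely_supported f : Prop := finite_set [set x | f x != 0].

Definition sup_norm f : \bar R := ereal_sup [set `|f x|%:E | x in [set: V]].

(* Only used with f finitely supported, so that this is a finite sum. *)
Definition inner f g : R := \sum_(x \in [set: V]) f x * g x * mass G x.

Definition recurrent : Prop := forall eps : R, 0 < eps ->
  exists f, [/\ finitely_supported f, sup_norm f = 1%E &
                - inner f (laplacian f) < eps].

(* Suprema over the neighbours of x, hence maxima when x has finitely many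
   neighbours and at least one. *)
Definition grad_plus f x : \bar R :=
  ereal_sup [set ((f y - f x) / dist G x y)%:E | y in [set y | adj y x]].

Definition grad_minus f x : \bar R :=
  ereal_sup [set ((f x - f y) / dist G x y)%:E | y in [set y | adj y x]].

End Definitions.

(* Main.v *)
Require Import Defs.
From HB Require Import structures.
From mathcomp Require Import all_boot all_order all_algebra.
From mathcomp Require Import finmap ring lra.
From mathcomp Require Import all_classical all_reals all_analysis.

Set Implicit Arguments.
Unset Strict Implicit.
Unset Printing Implicit Defensive.

Import Order.TTheory GRing.Theory Num.Theory.
Import numFieldNormedType.Exports.

Local Open Scope classical_set_scope.
Local Open Scope ring_scope.

(** Split the graph along a finite core [K] into two sides [X] and [Y] of
    infinite mass, and extend a 1-Lipschitz function on [K] as much as possible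
    on [X] and as little as possible on [Y].  Every point outside [K] then lies
    at full slope from a point of [K], so non-negative curvature bounds the
    Laplacian of the extension on [X] from above, and on [Y] from below, by its
    values on [K].  For small [eps] the map [I + eps Delta], followed by this
    extension, is non-expansive on Lipschitz functions on [K] modulo constants;
    a fixed point has constant Laplacian on [K], and the constant is 0, since
    otherwise Green's formula bounds the mass of one side by the flux through
    [K].  Comparing the fixed points for [K] and for larger cores by the maximum
    principle shows that they are harmonic everywhere and, up to constants,
    independent of the core.  Moving the core past a point yields neighbours at
    full slope in both directions, hence (iv) and flatness; truncations of the
    harmonic function prove recurrence.  With a third infinite component, it
    could be assigned to either side, and two harmonic functions with the same
    behaviour elsewhere, but opposite behaviour there, contradict uniqueness. *)

(** * Extrema and sums over finite sets *)

Lemma finite_argmin (R : realType) (T : choiceType) (K : set T) (f : T -> R) :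
  finite_set K -> K !=set0 -> exists2 x, K x & forall y, K y -> f x <= f y.
Proof.
move=> /finite_seqP[s ->]; elim: s => [|a s IH]; first by case=> x /=.
move=> _; have [s0|/set0P/IH[x /= xs xmin]] := eqVneq [set` s] set0.
  exists a; first by rewrite /= mem_head.
  move=> y /=; rewrite inE => /orP[/eqP->//|ys].
  by have : [set` s] y by []; rewrite s0.
have [ax|xa] := leP (f a) (f x).
- exists a; first by rewrite /= mem_head.
  move=> y /=; rewrite inE => /orP[/eqP->//|ys].
  exact: le_trans ax (xmin _ ys).
- exists x; first by rewrite /= inE xs orbT.
  move=> y /=; rewrite inE => /orP[/eqP->//|ys]; first exact: ltW.
  exact: xmin.
Qed.

Lemma finite_argmax (R : realType) (T : choiceType) (K : set T) (f : T -> R) :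
  finite_set K -> K !=set0 -> exists2 x, K x & forall y, K y -> f y <= f x.
Proof.
move=> finK K0; have [x Kx xmin] := finite_argmin (fun x => - f x) finK K0.
by exists x => // y /xmin; rewrite lerN2.
Qed.

(** Only [s] must be free of repetitions: those in [t] just add nonnegative terms. *)
Lemma ler_sum_support (R : realType) (T : choiceType) (s t : seq T)
    (h : T -> R) : uniq s -> (forall x, 0 <= h x) ->
  (forall x, x \notin t -> h x = 0) ->
  \sum_(x <- s) h x <= \sum_(x <- t) h x.
Proof.
move=> us h0 ht; rewrite -(undup_id us).
rewrite (bigID (mem t)) /= [X in _ + X]big1 ?addr0; last by move=> x /ht.
apply: (@le_trans _ _ (\sum_(x <- undup t) h x)).
  rewrite [leRHS](bigID (mem s)) /= undup_id // -[leLHS]addr0.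
  apply: lerD; last exact: sumr_ge0.
  rewrite -big_filter -[leRHS]big_filter le_eqVlt; apply/orP; left; apply/eqP.
  apply: perm_big; apply: uniq_perm; rewrite ?filter_uniq ?undup_uniq //.
  by move=> x; rewrite !mem_filter mem_undup andbC.
elim: t {ht} => //= a t IH; rewrite big_cons; case: ifP => _.
  by rewrite -[leLHS]add0r lerD.
by rewrite big_cons lerD2l.
Qed.

(** * Laplacian, geodesic steps, curvature and Green's formula *)

Section GraphBasics.
Context {R : realType} {V : countType} (G : weighted_graph R V).
Implicit Types (x y z : V) (f g : V -> R) (A K X Y : set V).

(** A salami without its partition, so that partitions can be varied over a fixed graph. *)
Record nonneg_curved : Prop := NonnegCurved {
  nc_connected : connected_graph G ;
  nc_locally_finite : locally_finite G ;
  nc_path_metric : path_metric G ;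
  nc_finite_balls : finite_balls G ;
  nc_nonneg_ollivier : nonneg_ollivier G
}.

Hypothesis hG : nonneg_curved.

Definition nbrs x : seq V := fset_set [set y | adj G x y].

Lemma adj_sym x y : adj G x y = adj G y x.
Proof. by rewrite /adj weight_sym. Qed.

Lemma adj_neq x y : adj G x y -> x <> y.
Proof. by rewrite /adj => + e; rewrite e weight_diag ltxx. Qed.

Lemma dist_gt0 x y : x <> y -> 0 < dist G x y.
Proof.
by move=> nxy; rewrite lt_neqAle dist_ge0 andbT eq_sym; apply/eqP => /dist_eq0.
Qed.

Lemma dist_xx x : dist G x x = 0.
Proof. exact/dist_eq0. Qed.

Lemma mem_nbrs x y : (y \in nbrs x) = adj G x y.
Proof. by rewrite in_fset_set ?mem_setE //; exact: (nc_locally_finite hG). Qed.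

Lemma nbrs_uniq x : uniq (nbrs x).
Proof. exact: fset_uniq. Qed.

Lemma weight_off_nbrs x y : y \notin nbrs x -> weight G x y = 0.
Proof.
by rewrite mem_nbrs /adj -leNgt => ?; apply/le_anti; rewrite weight_ge0 andbT.
Qed.

Lemma laplacianE f x : laplacian G f x =
  (mass G x)^-1 * \sum_(y <- nbrs x) weight G x y * (f y - f x).
Proof.
congr (_ * _); apply: fsbigTE => y /weight_off_nbrs ->.
by rewrite mul0r.
Qed.

Lemma mass_laplacian f x : mass G x * laplacian G f x =
  \sum_(y <- nbrs x) weight G x y * (f y - f x).
Proof. by rewrite laplacianE mulVKf // gt_eqF // mass_gt0. Qed.

Lemma mass_inv_ge0 x : 0 <= (mass G x)^-1.
Proof. by rewrite invr_ge0 ltW // mass_gt0. Qed.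

Lemma laplacian_lin a b f g x :
  laplacian G (fun y => a * f y + b * g y) x =
  a * laplacian G f x + b * laplacian G g x.
Proof.
rewrite !laplacianE !(mulrCA _ (mass G x)^-1) -mulrDr; congr (_ * _).
rewrite !mulr_sumr -big_split /=; apply: eq_bigr => y _; lra.
Qed.

Lemma laplacianN f x : laplacian G (fun y => - f y) x = - laplacian G f x.
Proof.
have := laplacian_lin (-1) 0 f f x.
rewrite mul0r addr0 mulN1r => <-; congr laplacian.
by apply/funext => y; rewrite mulN1r mul0r addr0.
Qed.

Lemma laplacianB f g x :
  laplacian G (fun y => f y - g y) x = laplacian G f x - laplacian G g x.
Proof.
have := laplacian_lin 1 (-1) f g x; rewrite !mul1r mulN1r => <-.
by congr laplacian; apply/funext => y; rewrite mul1r mulN1r.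
Qed.

Lemma laplacianDc f c x : laplacian G (fun y => f y + c) x = laplacian G f x.
Proof.
by rewrite !laplacianE; congr (_ * _); apply: eq_bigr => y _; congr (_ * _); lra.
Qed.

Lemma ler_laplacian f g x : (forall y, adj G x y -> f y - f x <= g y - g x) ->
  laplacian G f x <= laplacian G g x.
Proof.
move=> fg; rewrite !laplacianE; apply: (ler_wpM2l (mass_inv_ge0 x)).
rewrite big_seq [leRHS]big_seq; apply: ler_sum => y.
by rewrite mem_nbrs => xy; apply: ler_wpM2l; rewrite ?weight_ge0 ?fg.
Qed.

(** At a local minimum the Laplacian is a sum of nonnegative terms; if it is at most 0, each term
    vanishes. *)
Lemma laplacian_min f x : (forall y, adj G x y -> f x <= f y) ->
  laplacian G f x <= 0 ->
  laplacian G f x = 0 /\ forall y, adj G x y -> f y = f x.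
Proof.
move=> fmin lap0.
have t0 y : y \in nbrs x -> 0 <= weight G x y * (f y - f x).
  by rewrite mem_nbrs => xy; rewrite mulr_ge0 ?weight_ge0 // subr_ge0 fmin.
have : mass G x * laplacian G f x <= 0 by rewrite pmulr_rle0 // mass_gt0.
rewrite mass_laplacian => s0.
have {}s0 : \sum_(y <- nbrs x) weight G x y * (f y - f x) = 0.
  by apply/le_anti; rewrite s0 big_seq sumr_ge0.
split; first by rewrite laplacianE s0 mulr0.
move=> y xy; move: s0; rewrite big_seq => /eqP.
rewrite psumr_eq0 // => /allP/(_ y); rewrite mem_nbrs xy => /(_ isT) /=.
by rewrite mulf_eq0 gt_eqF //= subr_eq0 => /eqP.
Qed.

(** The first edge of a geodesic. By local finiteness [dist G x z + dist G z y] has a minimum over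
    the neighbours [z], and this minimum bounds the length of every walk to [y] from below. *)
Lemma dist_step x y : x <> y -> exists z,
  [/\ adj G x z, dist G x y = dist G x z + dist G z y & dist G z y < dist G x y].
Proof.
move=> nxy; pose h z := dist G x z + dist G z y.
have walkh p : walk G x p y -> exists2 z, adj G x z & h z <= walk_length G x p.
  case: p => [|z p] [] /=; first by move=> _ /nxy.
  move=> /andP[xz pth lst]; exists z => //.
  rewrite /walk_length /= big_cons lerD2l.
  have : ((dist G z y)%:E <= (walk_length G z p)%:E)%E.
    rewrite (nc_path_metric hG); apply: ereal_inf_lbound.
    by exists p.
  by rewrite lee_fin.
have N0 : [set z | adj G x z] !=set0.
  have [p /walkh[z xz _]] := nc_connected hG x y.
  by exists z.
have [z xz zmin] := finite_argmin h (nc_locally_finite hG x) N0.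
have xzy : dist G x y = h z.
  apply/le_anti; rewrite dist_triangle andTb.
  rewrite -lee_fin nc_path_metric //; apply/ereal_infP => _ [p /walkh[u xu up] <-].
  by rewrite lee_fin; apply: le_trans up; exact: zmin.
exists z; split => //; rewrite xzy ltrDr.
exact/dist_gt0/adj_neq.
Qed.

(** Distances are real, but balls are finite: the number of points at most as far from [o] as [x]
    serves as the induction measure. *)
Lemma dist_ind o (P : V -> Prop) :
  (forall x, (forall z, dist G z o < dist G x o -> P z) -> P x) ->
  forall x, P x.
Proof.
move=> IH x.
have [n] := ubnP #|` fset_set [set z | dist G o z <= dist G o x]|%fset.
elim: n x => // n IHn x; rewrite ltnS => le_n; apply: IH => z zx.
apply: IHn; apply: leq_trans le_n; apply: fproper_ltn_card.
have mb (u w : V) : (w \in fset_set [set z | dist G o z <= dist G o u]) =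
    (dist G o w <= dist G o u).
  by rewrite in_fset_set ?mem_setE //; exact: (nc_finite_balls hG).
rewrite ![dist G _ o]dist_sym in zx.
rewrite fproperE; apply/andP; split; [apply/fsubsetP => w | apply/fsubsetPn].
  by rewrite !mb => /le_trans; apply; exact: ltW.
by exists x; rewrite mb // -ltNge.
Qed.

Lemma curvature_adj f x y : Lip1 G f -> adj G x y -> f y - f x = dist G x y ->
  laplacian G f y <= laplacian G f x.
Proof.
move=> fL xy fxy; rewrite -subr_ge0 -lee_fin.
have := nc_nonneg_ollivier hG xy; rewrite /kappa pmule_rge0; last first.
  by rewrite lte_fin invr_gt0; exact/dist_gt0/adj_neq.
move=> /le_trans; apply; apply: ereal_inf_lbound.
by exists f.
Qed.

(** The inequality for edges chains along a geodesic, because a 1-Lipschitz function of full slope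
    between the endpoints has full slope on every step. *)
Lemma curvature f x y : Lip1 G f -> f y - f x = dist G x y ->
  laplacian G f y <= laplacian G f x.
Proof.
move=> fL; elim/(dist_ind (o := y)): x => x IH fxy.
have [->//|/eqP nxy] := eqVneq x y.
have [z [xz xzy zy]] := dist_step nxy.
have := fL x z; have := fL z y => zy1 xz1.
apply: le_trans (IH z zy _) (curvature_adj fL xz _); lra.
Qed.

Definition degree x := (mass G x)^-1 * \sum_(y <- nbrs x) weight G x y.

Lemma degree_ge0 x : 0 <= degree x.
Proof.
apply: (mulr_ge0 (mass_inv_ge0 x)).
by apply: sumr_ge0 => y _; exact: weight_ge0.
Qed.

Lemma laplacian_bound f x a : (forall y, adj G x y -> f y - f x <= a) ->
  laplacian G f x <= degree x * a.
Proof.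
move=> fa; rewrite laplacianE -mulrA; apply: (ler_wpM2l (mass_inv_ge0 x)).
rewrite mulr_suml big_seq [leRHS]big_seq; apply: ler_sum => y.
by rewrite mem_nbrs => xy; apply: ler_wpM2l; rewrite ?weight_ge0 ?fa.
Qed.

(* Raising [f] to [max f (f x + d x y - d y _)] makes the slope between [x] and
   [y] maximal, at the price of the slack [s = d x y - (f y - f x)]. *)
Lemma lazy_walk_Lip f eps x y : Lip1 G f -> 0 <= eps ->
  eps * (degree x + degree y) <= 1 -> x <> y ->
  (f y + eps * laplacian G f y) - (f x + eps * laplacian G f x) <= dist G x y.
Proof.
move=> fL eps0 eps1 nxy.
pose s := dist G x y - (f y - f x).
have s0 : 0 <= s by rewrite subr_ge0.
pose h z := Num.max (f z) (f x + dist G x y - dist G y z).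
have hf z : f z <= h z by rewrite le_max lexx.
have hs z : h z <= f z + s.
  rewrite ge_max; apply/andP; split; first lra.
  by have := fL z y; rewrite (dist_sym _ z y) /s; lra.
have hx : h x = f x by rewrite /h (dist_sym _ y x) addrK maxxx.
have hy : h y = f x + dist G x y.
  by rewrite /h dist_xx subr0; apply/max_idPr; have := fL x y; lra.
have hL : Lip1 G h.
  move=> u v; rewrite lerBlDl ge_max; apply/andP; split.
    by have := fL u v; have := hf u; lra.
  have : f x + dist G x y - dist G y u <= h u by rewrite le_max lexx orbT.
  by have := dist_triangle G y v u; rewrite (dist_sym _ v u); lra.
have hcurv := curvature hL (_ : h y - h x = dist G x y).
have {}hcurv : laplacian G h y <= laplacian G h x.
  by apply: hcurv; rewrite hx hy; lra.
(* The difference [h - f] takes values in [[0, s]], is 0 at [x] and [s] at [y]; this bounds the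
   change of both Laplacians. *)
have lx : laplacian G h x - laplacian G f x <= degree x * s.
  rewrite -laplacianB; apply: laplacian_bound => z _.
  by rewrite hx subrr subr0; have := hs z; lra.
have ly : laplacian G f y - laplacian G h y <= degree y * s.
  rewrite -laplacianB; apply: laplacian_bound => z _.
  by have := hf z; rewrite hy /s; lra.
have : eps * (laplacian G f y - laplacian G f x) <= eps * (degree x + degree y) * s.
  by rewrite -mulrA; apply: ler_wpM2l => //; lra.
have : eps * (degree x + degree y) * s <= s by rewrite ler_piMl.
by rewrite /s; lra.
Qed.

(** Edges inside [s] cancel by antisymmetry, which leaves the flux through the boundary. *)
Lemma green_sum f (s : seq V) : uniq s ->
  \sum_(x <- s) mass G x * laplacian G f x =
  \sum_(x <- s) \sum_(y <- nbrs x | y \notin s) weight G x y * (f y - f x).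
Proof.
move=> us; under eq_bigr do rewrite mass_laplacian (bigID (mem s)) /=.
rewrite big_split /= [X in X + _](_ : _ = 0) ?add0r //.
pose h x y := weight G x y * (f y - f x).
have hE x : \sum_(y <- nbrs x | y \in s) h x y = \sum_(y <- s) h x y.
  rewrite [RHS](bigID (mem (nbrs x))) /= [X in _ + X]big1 ?addr0; last first.
    by move=> y /weight_off_nbrs; rewrite /h => ->; rewrite mul0r.
  rewrite -big_filter -[RHS]big_filter; apply: perm_big.
  apply: uniq_perm; rewrite ?filter_uniq ?nbrs_uniq //.
  by move=> y; rewrite !mem_filter andbC.
under eq_bigr do rewrite hE.
have : \sum_(x <- s) \sum_(y <- s) h x y = - \sum_(x <- s) \sum_(y <- s) h x y.
  rewrite [LHS]exchange_big -sumrN; apply: eq_bigr => x _.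
  by rewrite -sumrN; apply: eq_bigr => y _; rewrite /h weight_sym; lra.
lra.
Qed.

End GraphBasics.

(** * Cuts, extremal extensions and their comparison *)

Section ExtremalExtension.
Context {R : realType} {V : countType} (G : weighted_graph R V).
Implicit Types (x y z k : V) (f g h u : V -> R) (A K X Y : set V).
Hypothesis hG : nonneg_curved G.

Record cut X Y K : Prop := Cut {
  cut_cover : forall x, [\/ X x, Y x | K x] ;
  cut_disj : forall x, X x -> ~ Y x ;
  cut_finite : finite_set K ;
  cut_edge : forall x y, X x -> Y y -> ~~ adj G x y
}.

Lemma cut_swap X Y K : cut X Y K -> cut Y X K.
Proof.
case=> cov dis fin edge; split=> //.
- by move=> x; case: (cov x); [constructor 2|constructor 1|constructor 3].
- by move=> x Yx Xx; exact: dis Yx.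
- by move=> x y Yx Xy; rewrite adj_sym edge.
Qed.

(* Outside [K], [g] is the largest 1-Lipschitz extension of its restriction to
   [K] on the side [X], and the smallest one on the side [Y]. *)
Definition extremal X Y K g : Prop :=
  [/\ Lip1 G g,
      forall x, X x -> exists2 y, K y & g x - g y = dist G x y &
      forall x, Y x -> exists2 y, K y & g y - g x = dist G x y].

Lemma extremalN X Y K g :
  extremal X Y K g -> extremal Y X K (fun x => - g x).
Proof.
case=> gL gX gY; split.
- by move=> x y; rewrite (dist_sym G x y); have := gL y x; lra.
- by move=> x /gY[y Ky gxy]; exists y => //; rewrite -gxy; lra.
- by move=> x /gX[y Ky gxy]; exists y => //; rewrite -gxy; lra.
Qed.

Lemma extremalDc X Y K g c :
  extremal X Y K g -> extremal X Y K (fun x => g x + c).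
Proof.
case=> gL gX gY; split.
- by move=> x y; have := gL x y; lra.
- by move=> x /gX[y Ky gxy]; exists y => //; rewrite -gxy; lra.
- by move=> x /gY[y Ky gxy]; exists y => //; rewrite -gxy; lra.
Qed.

Lemma extremal_sub X Y K X' Y' K' g : X' `<=` X -> Y' `<=` Y -> K `<=` K' ->
  extremal X Y K g -> extremal X' Y' K' g.
Proof.
move=> XX YY KK [gL gX gY]; split=> //.
- by move=> x /XX/gX[y /KK]; exists y.
- by move=> x /YY/gY[y /KK]; exists y.
Qed.

(** No edge joins the two sides, so a geodesic from [X] to [Y] has to pass through [K]. *)
Lemma cut_crossing X Y K x y : cut X Y K -> X x -> Y y ->
  exists2 k, K k & dist G x y = dist G x k + dist G k y.
Proof.
move=> cutK + Yy; elim/(dist_ind hG (o := y)): x => x IH Xx.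
have nxy : x <> y by move=> xy; apply: (cut_disj cutK Xx); rewrite xy.
have [z [xz xzy zy]] := dist_step hG nxy.
case: (cut_cover cutK z) => [Xz|Yz|Kz]; last by exists z.
- have [k Kk zky] := IH z zy Xz; exists k => //.
  apply/le_anti; rewrite dist_triangle /= xzy zky addrA lerD2r.
  exact: dist_triangle.
- by have := cut_edge cutK Xx Yz; rewrite xz.
Qed.

(** The two McShane extensions, upper on [X] and lower on [Y], are glued. Both agree with [f] on [K]
    and the lower one lies below the upper one. *)
Lemma extremal_extension X Y K f : cut X Y K -> K !=set0 ->
  (forall x y, K x -> K y -> f y - f x <= dist G x y) ->
  exists2 g, extremal X Y K g & forall x, K x -> g x = f x.
Proof.
move=> cutK K0 fL; have finK := cut_finite cutK.
have /choice[a aP] x : exists a, K a /\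
    forall k, K k -> f a + dist G a x <= f k + dist G k x.
  by have [a] := finite_argmin (fun k => f k + dist G k x) finK K0; exists a.
have /choice[b bP] x : exists b, K b /\
    forall k, K k -> f k - dist G k x <= f b - dist G b x.
  by have [b] := finite_argmax (fun k => f k - dist G k x) finK K0; exists b.
pose gX x := f (a x) + dist G (a x) x.
pose gY x := f (b x) - dist G (b x) x.
have gXK x : K x -> gX x = f x.
  move=> Kx; apply/le_anti/andP; split.
    by have := (aP x).2 x Kx; rewrite dist_xx addr0.
  by rewrite /gX; have := fL _ _ (aP x).1 Kx; lra.
have gYK x : K x -> gY x = f x.
  move=> Kx; apply/le_anti/andP; split.
    by have := fL _ _ Kx (bP x).1; rewrite /gY (dist_sym G x); lra.
  by have := (bP x).2 x Kx; rewrite dist_xx subr0.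
have gXL x y : gX y - gX x <= dist G x y.
  have := (aP y).2 _ (aP x).1; have := dist_triangle G (a x) x y.
  by rewrite /gX; lra.
have gYL x y : gY y - gY x <= dist G x y.
  have := (bP x).2 _ (bP y).1; have := dist_triangle G (b y) y x.
  by rewrite /gY (dist_sym G y x); lra.
have gYX x : gY x <= gX x.
  have := fL _ _ (aP x).1 (bP x).1; have := dist_triangle G (a x) x (b x).
  by rewrite /gX /gY (dist_sym G x (b x)); lra.
pose g x := if x \in X then gX x else gY x.
have gXE x : X x -> g x = gX x by move=> Xx; rewrite /g mem_set.
have gYE x : ~ X x -> g x = gY x by move=> Xx; rewrite /g memNset.
have gK x : K x -> g x = f x.
  move=> Kx; have [Xx|nXx] := pselect (X x).
    by rewrite gXE // gXK.
  by rewrite gYE // gYK.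
exists g => //; split.
- move=> x y; have [Xx|nXx] := pselect (X x); have [Xy|nXy] := pselect (X y).
  + by rewrite !gXE.
  + by rewrite (gXE x) // (gYE y) //; have := gXL x y; have := gYX y; lra.
  + rewrite (gYE x) // (gXE y) //; case: (cut_cover cutK x) => // [Yx|Kx]; last first.
      by rewrite gYK // -(gXK x Kx).
    (* Here the ordering [gYX] goes the wrong way; instead both values are compared with [f k] at a
       point [k] of a geodesic. *)
    have [k Kk kP] := cut_crossing cutK Xy Yx.
    have := (aP y).2 k Kk; have := (bP x).2 k Kk.
    by rewrite (dist_sym G x y) kP /gX /gY (dist_sym G y k); lra.
  + by rewrite !gYE.
- move=> x Xx; exists (a x); first exact: (aP x).1.
  by rewrite (gXE x) // gK; [rewrite /gX dist_sym; lra|exact: (aP x).1].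
- move=> x Yx; exists (b x); first exact: (bP x).1.
  rewrite (gYE x); last by move=> Xx; exact: (cut_disj cutK Xx).
  by rewrite gK; [rewrite /gY dist_sym; lra|exact: (bP x).1].
Qed.

(** From [x] towards a suitable [y] in [K], [g] decreases at full slope, and [h] cannot decrease
    faster. Thus lower bounds for [g - h] on [K] persist on [X]. *)
Lemma extremal_compare_upper X Y K g h x :
  extremal X Y K g -> Lip1 G h -> X x ->
  exists2 y, K y & g y - h y <= g x - h x.
Proof.
case=> _ gX _ hL /gX[y Ky gxy]; exists y => //.
by have := hL y x; rewrite (dist_sym G y x); lra.
Qed.

Lemma extremal_compare_lower X Y K g h x :
  Lip1 G g -> extremal X Y K h -> Y x ->
  exists2 y, K y & g y - h y <= g x - h x.
Proof.
move=> gL [_ _ hY] /hY[y Ky hxy]; exists y => //.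
by have := gL x y; lra.
Qed.

Lemma extremal_compare X Y K g h x : cut X Y K ->
  extremal X Y K g -> extremal X Y K h ->
  exists2 y, K y & g y - h y <= g x - h x.
Proof.
move=> cutK gE hE; case: (cut_cover cutK x) => [Xx|Yx|Kx].
- by apply: (extremal_compare_upper gE _ Xx); case: hE.
- by apply: (extremal_compare_lower _ hE Yx); case: gE.
- by exists x; rewrite ?lexx.
Qed.

(** A bound on the oscillation, the natural seminorm modulo constants, phrased without suprema so
    that [K] may be all of [V]. *)
Definition osc K u (a : R) := forall x y, K x -> K y -> u x - u y <= a.

Lemma extremal_osc X Y K g h a : cut X Y K ->
  extremal X Y K g -> extremal X Y K h ->
  osc K (fun x => g x - h x) a -> osc setT (fun x => g x - h x) a.
Proof.
move=> cutK gE hE oK x y _ _.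
have [y' Ky' y'y] := extremal_compare y cutK gE hE.
have [x' Kx' x'x] := extremal_compare x cutK hE gE.
by have := oK x' y' Kx' Ky'; lra.
Qed.

(** One step of a lazy random walk: an average of values of [f] as soon as
    [eps * degree G x <= 1]. *)
Definition lazy eps f x := f x + eps * laplacian G f x.

Lemma lazyB eps f g x :
  lazy eps (fun y => f y - g y) x = lazy eps f x - lazy eps g x.
Proof. by rewrite /lazy laplacianB // mulrBr; lra. Qed.

(** Averages lie in the range of [u]. The averages at [x] and at [y] are treated in turn, each time
    against an upper bound valid at every vertex, which avoids the supremum of [u]. *)
Lemma lazy_osc eps u a x y : 0 <= eps -> eps * degree G x <= 1 ->
  eps * degree G y <= 1 -> osc setT u a -> lazy eps u x - lazy eps u y <= a.
Proof.
move=> eps0 ex ey ou.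
have le_lazy v z b : eps * degree G z <= 1 -> (forall w, v w <= b) ->
    lazy eps v z <= b.
  move=> ez vb.
  have : laplacian G v z <= degree G z * (b - v z).
    by apply: laplacian_bound => // w _; rewrite lerB.
  move=> /(ler_wpM2l eps0) lv.
  have : eps * degree G z * (b - v z) <= b - v z.
    by apply: ler_piMl; rewrite ?subr_ge0.
  by rewrite /lazy; lra.
have xz z : lazy eps u x - a <= u z.
  by rewrite lerBlDr; apply: le_lazy => // w; have := ou w z I I; lra.
have lazyN : lazy eps (fun z => - u z) y = - lazy eps u y.
  by rewrite /lazy laplacianN //; lra.
have : lazy eps (fun z => - u z) y <= a - lazy eps u x.
  by apply: le_lazy => // w; have := xz w; lra.
by rewrite lazyN; lra.
Qed.

Lemma bounded_dist K : finite_set K ->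
  exists2 M : R, 0 <= M & forall x y, K x -> K y -> dist G x y <= M.
Proof.
move=> finK; have [->|/set0P K0] := eqVneq K set0; first by exists 0.
have [c Kc] := K0.
have [a Ka aM] := finite_argmax (dist G c) finK K0.
exists (dist G c a + dist G c a); first by rewrite addr_ge0 ?dist_ge0.
move=> x y Kx Ky; apply: le_trans (dist_triangle G x c y) _.
by rewrite (dist_sym G x c) lerD ?aM.
Qed.

Lemma lazy_step_exists K : finite_set K -> exists2 eps : R, 0 < eps &
  forall x y, K x -> K y -> eps * (degree G x + degree G y) <= 1.
Proof.
move=> finK; have [->|/set0P K0] := eqVneq K set0; first by exists 1.
have [a Ka aM] := finite_argmax (degree G) finK K0.
have d0 := degree_ge0 G a.
exists (2 * (degree G a + 1))^-1; first by rewrite invr_gt0; lra.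
move=> x y Kx Ky; rewrite mulrC ler_pdivrMr; last lra.
by have := aM x Kx; have := aM y Ky; lra.
Qed.

End ExtremalExtension.

(** Compactness of a product of intervals: the limit along a free ultrafilter is approached on
    finitely many coordinates at once. *)
Lemma pointwise_cluster (R : realType) (V : countType) (f_ : nat -> V -> R)
    (b : V -> R) : (forall n x, `|f_ n x| <= b x) ->
  exists g : V -> R, forall (s : seq V) (delta : R) (N : nat), 0 < delta ->
    exists2 n, (N <= n)%N & forall x, x \in s -> `|f_ n x - g x| < delta.
Proof.
move=> fb; have [U [ultraU ooU]] := @ultraFilterLemma nat \oo _.
have UT (A : set nat) : (forall n, A n) -> U A by move=> An; exact: filterE.
(* The supremum of [S x] is the limit of [f_ n x] along [U]. *)
pose S x := [set a | U [set n | a <= f_ n x]].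
have Sb x a : S x a -> a <= b x.
  rewrite leNgt => Sa; apply/negP => ba; have [n /= an] := filter_ex Sa.
  have := le_lt_trans (ler_norm (f_ n x)) (le_lt_trans (fb n x) ba).
  by rewrite ltNge an.
have supS x : has_sup (S x).
  split; last by exists (b x) => a; exact: Sb.
  by exists (- b x); apply: UT => n /=; have := fb n x; rewrite ler_norml => /andP[].
exists (fun x => sup (S x)) => s delta N delta0.
have Ux x : U [set n | `|f_ n x - sup (S x)| < delta].
  have [a Sa ga] := sup_adherent delta0 (supS x).
  have [Ug|Ug] := in_ultra_setVsetC [set n | sup (S x) + delta <= f_ n x] ultraU.
    have := sup_upper_bound (supS x) Ug; lra.
  have Sa' : U [set n | a <= f_ n x] by [].
  apply: filterS2 Ug Sa' => n /= /negP; rewrite -ltNge => gn an.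
  by rewrite ltr_norml; lra.
have Us : U [set n | forall x, x \in s -> `|f_ n x - sup (S x)| < delta].
  elim: s => [|y s IH]; first exact: UT.
  apply: filterS2 (Ux y) IH => n /= ny ns x.
  by rewrite inE => /orP[/eqP->|/ns].
have UN : U [set n | (N <= n)%N] by apply: ooU; exists N.
by have [n [/= Nn ns]] := filter_ex (filterI UN Us); exists n.
Qed.

(** * Extremal functions whose Laplacian is constant on the core *)

Section ConstantLaplacian.
Context {R : realType} {V : countType} (G : weighted_graph R V).
Implicit Types (x y z k : V) (f g h u : V -> R) (A K X Y : set V).
Hypothesis hG : nonneg_curved G.

(* [f |-> lam * lazy eps f], read on [K] and extended extremally, contracts the
   oscillation on [K] by the factor [lam]; so do the residuals of its orbit. *)
Lemma almost_fixed X Y K eps M lam n : cut G X Y K -> K !=set0 -> 0 < eps ->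
  (forall x y, K x -> K y -> eps * (degree G x + degree G y) <= 1) ->
  (forall x y, K x -> K y -> dist G x y <= M) ->
  0 <= lam <= 1 ->
  exists2 f, extremal G X Y K f &
    osc K (fun x => lam * lazy G eps f x - f x) (lam ^+ n * (2 * M)).
Proof.
move=> cutK K0 eps0 epsK MK /andP[lam0 lam1].
have lazyL f x y : Lip1 G f -> K x -> K y ->
    lam * lazy G eps f y - lam * lazy G eps f x <= lam * dist G x y.
  move=> fL Kx Ky; rewrite -mulrBr; apply: ler_wpM2l => //.
  have [->|/eqP nxy] := eqVneq x y; first by rewrite subrr dist_ge0.
  exact: (lazy_walk_Lip hG fL (ltW eps0) (epsK _ _ Kx Ky) nxy).
have lamd x y : lam * dist G x y <= dist G x y by rewrite ler_piMl ?dist_ge0.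
elim: n => [|n [f fE fosc]].
  have [f fE _] : exists2 g, extremal G X Y K g & forall x, K x -> g x = 0.
    by apply: extremal_extension => // x y _ _; rewrite subrr dist_ge0.
  (* The residual is a difference of two functions that oscillate by at most [M] on [K], hence
     [2 * M]. *)
  exists f => // x y Kx Ky; rewrite expr0 mul1r.
  have [fL _ _] := fE; have := lazyL f y x fL Ky Kx; have := lamd y x.
  by have := fL x y; have := MK x y Kx Ky; have := MK y x Ky Kx; lra.
have [fL _ _] := fE.
have [h hE hf] : exists2 g, extremal G X Y K g &
    forall x, K x -> g x = lam * lazy G eps f x.
  apply: extremal_extension => // x y Kx Ky.
  exact: le_trans (lazyL f x y fL Kx Ky) (lamd x y).
exists h => // x y Kx Ky; rewrite (hf x Kx) (hf y Ky).
(* On [K], [h - f] is the previous residual. Extremality carries its oscillation bound to all of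
   [V], averaging preserves it, and [lam] then contracts it. *)
have : lazy G eps (fun z => h z - f z) x - lazy G eps (fun z => h z - f z) y
    <= lam ^+ n * (2 * M).
  have deg z : K z -> eps * degree G z <= 1.
    move=> Kz; apply: le_trans (epsK z z Kz Kz).
    by apply: ler_wpM2l; [exact: ltW|rewrite lerDl degree_ge0].
  apply: (lazy_osc hG (ltW eps0) (deg x Kx) (deg y Ky)).
  apply: (extremal_osc cutK hE fE) => u v Ku Kv.
  by rewrite (hf u Ku) (hf v Kv); exact: fosc.
rewrite !lazyB // => /(ler_wpM2l lam0); rewrite exprS; lra.
Qed.

(** With [lam = 1 - t] the residual of [f] is [eps * laplacian G f - t * lazy G eps f]; a small
    residual and a small [t] make the Laplacian nearly constant on [K]. *)
Lemma almost_constant_laplacian X Y K delta : cut G X Y K -> K !=set0 ->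
  0 < delta -> exists2 f, extremal G X Y K f & osc K (laplacian G f) delta.
Proof.
move=> cutK K0 delta0.
have [eps eps0 epsK] := lazy_step_exists G (cut_finite cutK).
have [M M0 MK] := bounded_dist G (cut_finite cutK).
have ed0 : 0 < eps * delta by exact: mulr_gt0.
(* Half of [eps * delta] is reserved for [t * M] and half for the residual; the summand
   [eps * delta] in the denominator keeps [t < 1] even if [M = 0]. *)
pose t := eps * delta / (2 * (M + eps * delta)).
have den0 : 0 < 2 * (M + eps * delta) by lra.
have t0 : 0 < t by exact: divr_gt0.
have t1 : t < 1 by rewrite ltr_pdivrMr //; lra.
have tM : t * (2 * M) <= eps * delta.
  rewrite mulrAC ler_pdivrMr // ler_pM2l //; lra.
have lam01 : 0 <= 1 - t <= 1 by lra.
have [n nP] : exists n, (1 - t) ^+ n * (2 * M) <= eps * delta / 2.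
  have : (fun n => (1 - t) ^+ n * (2 * M)) @ \oo --> (0 * (2 * M) : R).
    by apply: cvgMl; apply: cvg_expr; rewrite ger0_norm; lra.
  rewrite mul0r => /cvgrPdist_lt/(_ (eps * delta / 2)).
  rewrite divr_gt0 // => /(_ isT) near0.
  have [n] := filter_ex near0; rewrite sub0r normrN => nP.
  by exists n; exact: le_trans (ler_norm _) (ltW nP).
have [f fE fosc] := almost_fixed n cutK K0 eps0 epsK MK lam01.
exists f => // x y Kx Ky; have := fosc x y Kx Ky.
have [fL _ _] := fE.
have : lazy G eps f y - lazy G eps f x <= M.
  have [->|/eqP nxy] := eqVneq x y; first by rewrite subrr.
  apply: le_trans (MK x y Kx Ky).
  exact: (lazy_walk_Lip hG fL (ltW eps0) (epsK _ _ Kx Ky) nxy).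
have : lazy G eps f x - lazy G eps f y <= M.
  have [->|/eqP nyx] := eqVneq y x; first by rewrite subrr.
  apply: le_trans (MK y x Ky Kx).
  exact: (lazy_walk_Lip hG fL (ltW eps0) (epsK _ _ Ky Kx) nyx).
move=> /(ler_wpM2l (ltW t0)) l1 _ l2.
rewrite -(ler_pM2l eps0); move: l1 l2; rewrite /lazy; lra.
Qed.

(** As [K] is finite, failure of the conclusion would leave a positive least gap, which a close
    enough function satisfying [P] contradicts. *)
Lemma limit_upper K g x (P : (V -> R) -> Prop) : finite_set K -> K !=set0 ->
  Lip1 G g ->
  (forall f, P f -> exists2 y, K y & f x - f y = dist G x y) ->
  (forall (s : seq V) (delta : R), 0 < delta -> exists2 f, P f &
    forall y, y \in s -> `|f y - g y| < delta) ->
  exists2 y, K y & g x - g y = dist G x y.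
Proof.
move=> finK K0 gL PK gP.
have [y Ky ymin] := finite_argmin (fun y => dist G x y - (g x - g y)) finK K0.
have [gap|gap] := leP (dist G x y - (g x - g y)) 0.
  by exists y => //; have := gL y x; rewrite (dist_sym G y x); lra.
(* A third of the gap, since errors occur at two points, [x] and [z]. *)
pose delta := (dist G x y - (g x - g y)) / 3.
have delta0 : 0 < delta by rewrite divr_gt0.
have [f /PK[z Kz fz] fs] := gP (x :: fset_set K) delta delta0.
have := ymin z Kz.
have := fs x (mem_head _ _); have : z \in x :: fset_set K.
  by rewrite inE in_fset_set // mem_set // orbT.
by move=> /fs; rewrite !ltr_norml /delta; lra.
Qed.

Lemma limit_extremal X Y K g : finite_set K -> K !=set0 ->
  (forall (s : seq V) (delta : R), 0 < delta -> exists2 f, extremal G X Y K f &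
    forall y, y \in s -> `|f y - g y| < delta) ->
  extremal G X Y K g.
Proof.
move=> finK K0 gP.
have gL : Lip1 G g.
  move=> x y; apply/ler_addgt0Pr => e e0.
  have e20 : 0 < e / 2 by rewrite divr_gt0.
  have [f [fL _ _] fs] := gP [:: x; y] _ e20.
  have := fL x y; have := fs x (mem_head _ _).
  have : y \in [:: x; y] by rewrite !inE eqxx orbT.
  by move=> /fs; rewrite !ltr_norml; lra.
split=> // x xXY.
  by apply: (limit_upper finK K0 gL _ gP) => f [_ + _]; apply.
have gLN : Lip1 G (fun z => - g z).
  by move=> u v; rewrite (dist_sym G u v); have := gL v u; lra.
have gPN (s : seq V) (delta : R) : 0 < delta ->
    exists2 f, extremal G Y X K f & forall y, y \in s -> `|f y - - g y| < delta.
  move=> /(gP s)[f fE fs]; exists (fun z => - f z); first exact: extremalN.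
  by move=> y /fs; rewrite -opprD normrN.
have [|y Ky gxy] := limit_upper finK K0 gLN _ gPN (x := x).
  by move=> f [_ + _]; apply.
by exists y => //; lra.
Qed.

(** Almost constant solutions normalised at one point of [K] are bounded by the distance to it, so
    they have a cluster point; at each vertex the Laplacian involves finitely many values only. *)
Lemma constant_laplacian X Y K : cut G X Y K -> K !=set0 ->
  exists g c, extremal G X Y K g /\ forall x, K x -> laplacian G g x = c.
Proof.
move=> cutK K0; have finK := cut_finite cutK; have [a Ka] := K0.
have /choice[f_ fP] (n : nat) : exists f, [/\ extremal G X Y K f, f a = 0 &
    osc K (laplacian G f) n.+1%:R^-1].
  have [f fE fosc] : exists2 f, extremal G X Y K f &
      osc K (laplacian G f) n.+1%:R^-1.
    by apply: almost_constant_laplacian.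
  exists (fun x => f x - f a); split; [exact: extremalDc|exact: subrr|].
  by move=> x y Kx Ky; rewrite !laplacianDc //; exact: fosc.
have fb n x : `|f_ n x| <= dist G a x.
  have [[fL _ _] fa _] := fP n.
  have := fL a x; have := fL x a; rewrite (dist_sym G x a) fa.
  by rewrite ler_norml; lra.
have [g gP] := pointwise_cluster fb.
have gE : extremal G X Y K g.
  apply: limit_extremal => // s delta delta0.
  have [n _ nP] := gP s delta 0%N delta0.
  by exists (f_ n) => //; case: (fP n).
exists g, (laplacian G g a); split=> // x Kx.
suff le_lap y z : K y -> K z -> laplacian G g y <= laplacian G g z.
  by apply/le_anti/andP; split; exact: le_lap.
move=> Ky Kz; apply/ler_addgt0Pr => e e0.
have dy0 := degree_ge0 G y; have dz0 := degree_ge0 G z.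
(* Errors of [e / (4 * D)] at the vertices involved change the two Laplacians by at most [e / 2] in
   total; the other half of [e] absorbs the oscillation of the Laplacian of [f_ n]. *)
pose D := 1 + degree G y + degree G z.
have D1 : 0 < D by rewrite /D; lra.
have D0 : 0 < 4 * D by rewrite mulr_gt0.
have [N _ Ne] : exists2 N, (0 <= N)%N & N.+1%:R^-1 < e / 2.
  have e20 : 0 < e / 2 by rewrite divr_gt0.
  have [N _ /(_ N (leqnn N)) NP] := near_infty_natSinv_lt (PosNum e20).
  by exists N.
have [n Nn nP] := gP ([:: y, z & nbrs G y ++ nbrs G z]) (e / (4 * D)) N
  (divr_gt0 e0 D0).
have [_ _ /(_ y z Ky Kz) fosc] := fP n.
have ninv : n.+1%:R^-1 <= N.+1%:R^-1 :> R.
  by rewrite lef_pV2 ?posrE ?ltr0n // ler_nat.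
have lap_close (u v : V -> R) w : u = f_ n /\ v = g \/ u = g /\ v = f_ n ->
    w = y \/ w = z ->
    laplacian G u w - laplacian G v w <= degree G w * (e / (2 * D)).
  move=> uv wyz; rewrite -laplacianB //; apply: laplacian_bound => // w' ww'.
  have wP : `|f_ n w - g w| < e / (4 * D).
    by apply: nP; case: wyz => ->; rewrite !inE eqxx ?orbT.
  have wP' : `|f_ n w' - g w'| < e / (4 * D).
    by apply: nP; rewrite !inE mem_cat !mem_nbrs //; case: wyz => <-;
      rewrite ww' ?orbT.
  have -> : e / (2 * D) = e / (4 * D) + e / (4 * D) by field; exact: lt0r_neq0.
  by move: wP wP'; rewrite !ltr_norml; case: uv => -[-> ->]; lra.
have ly := lap_close g (f_ n) y (or_intror (conj erefl erefl)) (or_introl erefl).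
have lz := lap_close (f_ n) g z (or_introl (conj erefl erefl)) (or_intror erefl).
have : (degree G y + degree G z) * (e / (2 * D)) <= e / 2.
  rewrite mulrA ler_pdivrMr; last lra.
  by rewrite /D; nra.
have : laplacian G (f_ n) y - laplacian G (f_ n) z < e / 2.
  exact: le_lt_trans fosc (le_lt_trans ninv Ne).
move: ly lz; set q := e / (2 * D); lra.
Qed.

End ConstantLaplacian.

(** * Infinite mass forces the constant Laplacian to vanish *)

Section Mass.
Context {R : realType} {V : countType} (G : weighted_graph R V).
Implicit Types (x y z k : V) (f g h u : V -> R) (A F K X Y : set V).

Lemma set_mass_le X (B : R) :
  (forall s : seq V, uniq s -> (forall x, x \in s -> X x) ->
    \sum_(x <- s) mass G x <= B) ->
  (set_mass G X <= B%:E)%E.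
Proof.
move=> sB; apply: ge_ereal_sup => _ [A [finA AX] <-].
rewrite fsbig_finite // sumEFin lee_fin; apply: sB; first exact: fset_uniq.
by move=> x; rewrite in_fset_set // => /set_mem/AX.
Qed.

Lemma set_mass_sub X Y : X `<=` Y -> (set_mass G X <= set_mass G Y)%E.
Proof.
move=> XY; apply: le_ereal_sup => _ [A [finA AX] <-].
by exists A => //; split=> //; exact: subset_trans XY.
Qed.

Lemma set_mass_subpinfty X Y : X `<=` Y -> set_mass G X = +oo%E ->
  set_mass G Y = +oo%E.
Proof.
move=> /set_mass_sub XY Xoo; apply/eqP.
by rewrite eq_le leey -Xoo.
Qed.

Lemma set_massU X Y : set_mass G (X `|` Y) = +oo%E ->
  set_mass G X = +oo%E \/ set_mass G Y = +oo%E.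
Proof.
move=> XYoo; have [Xoo|Xfin] := eqVneq (set_mass G X) +oo%E; first by left.
right; apply/eqP; apply: contraPT XYoo => Yfin.
rewrite /set_mass (esumID X); last by move=> x _; rewrite lee_fin ltW // mass_gt0.
apply/eqP; rewrite lt_eqF //; apply: lte_add_pinfty.
  apply: (@le_lt_trans _ _ (set_mass G X)); last by rewrite ltey.
  by apply: set_mass_sub => x [].
apply: (@le_lt_trans _ _ (set_mass G Y)); last by rewrite ltey.
by apply: set_mass_sub => x [[]].
Qed.

Lemma set_mass_finite F : finite_set F -> set_mass G F <> +oo%E.
Proof.
move=> finF; rewrite /set_mass esum_fset //; last first.
  by move=> x _; rewrite lee_fin ltW // mass_gt0.
by rewrite fsbig_finite // sumEFin.
Qed.

Lemma set_massD X F : finite_set F -> set_mass G X = +oo%E ->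
  set_mass G (X `\` F) = +oo%E.
Proof.
move=> finF Xoo; have [//|//|/(set_mass_finite finF)//] := @set_massU (X `\` F) F.
by apply: set_mass_subpinfty Xoo => x Xx; have [?|?] := pselect (F x); [right|left].
Qed.

Record salami_cut X Y K : Prop := SalamiCut {
  salami_cutP : cut G X Y K ;
  salami_cut_massX : set_mass G X = +oo%E ;
  salami_cut_massY : set_mass G Y = +oo%E
}.

Lemma salami_cut_swap X Y K : salami_cut X Y K -> salami_cut Y X K.
Proof. by case=> cutK Xoo Yoo; split=> //; exact: cut_swap. Qed.

Lemma salami_partition_cut X Y K : salami_partition G X Y K -> salami_cut X Y K.
Proof.
case=> cov dXY _ _ finK edge Xoo Yoo; split=> //; split=> //.
- move=> x; have : (X `|` Y `|` K) x by rewrite cov.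
  by case=> [[]|]; [constructor 1|constructor 2|constructor 3].
- by move=> x Xx Yx; have : (X `&` Y) x by []; rewrite dXY.
Qed.

(** Cores can be enlarged at will, since finite sets have finite mass. *)
Lemma salami_cutD X Y K F : salami_cut X Y K -> finite_set F -> K `<=` F ->
  salami_cut (X `\` F) (Y `\` F) F.
Proof.
case=> cutK Xoo Yoo finF KF; split; [|exact: set_massD..].
split=> //.
- move=> x; have [Fx|nFx] := pselect (F x); first by constructor 3.
  by case: (cut_cover cutK x) => [Xx|Yx|/KF//]; [constructor 1|constructor 2].
- by move=> x [Xx _] [Yx _]; exact: (cut_disj cutK Xx).
- by move=> x y [Xx _] [Yx _]; exact: (cut_edge cutK).
Qed.

Hypothesis hG : nonneg_curved G.

Lemma set_mass_nonempty X : set_mass G X = +oo%E -> X !=set0.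
Proof.
by move=> Xoo; apply/set0P/eqP => X0; move: Xoo; apply: set_mass_finite; rewrite X0.
Qed.

Lemma salami_cut_nonempty X Y K : salami_cut X Y K -> K !=set0.
Proof.
case=> cutK /set_mass_nonempty[x Xx] /set_mass_nonempty[y Yy].
by have [k Kk _] := cut_crossing hG cutK Xx Yy; exists k.
Qed.

(** On [X], [g] grows at full slope away from [K], so its sublevel sets lie in finitely many
    balls. *)
Lemma extremal_sublevel_finite X Y K g r : finite_set K ->
  extremal G X Y K g -> finite_set [set x | X x /\ g x <= r].
Proof.
move=> finK [_ gX _].
apply: (@sub_finite_set _ _ (\bigcup_(k in K) [set x | dist G k x <= r - g k])).
  move=> x [/gX[k Kk gxk] gr]; exists k => //=.
  by rewrite dist_sym -gxk lerB.
by apply: bigcup_finite => // k _; exact: (nc_finite_balls hG).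
Qed.

(* Through the boundary of [{x in X | g x <= r}], the flux of [g] is outgoing
   away from [K]; so its total is at least the flux out of [K], which does not
   depend on [r], whereas it is at most [c] times the mass. *)
Lemma negative_laplacian_mass X Y K g c : cut G X Y K -> extremal G X Y K g ->
  c < 0 -> (forall x, X x -> laplacian G g x <= c) -> set_mass G X <> +oo%E.
Proof.
move=> cutK gE c0 gc.
have finK := cut_finite cutK.
pose flux x y := weight G x y * `|g y - g x|.
have flux_ge0 x y : 0 <= flux x y by rewrite mulr_ge0 ?weight_ge0.
(* This bound on the flux through [K] depends on neither [t] nor the level [r] below. *)
pose D := \sum_(k <- fset_set K) \sum_(x <- nbrs G k) flux x k.
suff : (set_mass G X <= (D / - c)%:E)%E.
  by move=> + Xoo; rewrite Xoo leye_eq.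
apply: set_mass_le => t ut tX.
rewrite ler_pdivlMr ?oppr_gt0 //.
pose r := \sum_(x <- t) `|g x|.
have gr x : x \in t -> g x <= r.
  move=> xt; apply: le_trans (ler_norm _) _.
  by rewrite /r (big_rem x xt) /= lerDl sumr_ge0.
have finA := extremal_sublevel_finite r finK gE.
pose s : seq V := fset_set [set x | X x /\ g x <= r].
have sE x : (x \in s) = `[< X x /\ g x <= r >].
  by rewrite in_fset_set.
have sX x : x \in s -> X x by rewrite sE => /asboolP[].
have us : uniq s by exact: fset_uniq.
have ts : \sum_(x <- t) mass G x <= \sum_(x <- s) mass G x.
  have tE : \sum_(x <- t) mass G x =
      \sum_(x <- t) (if x \in t then mass G x else 0).
    by rewrite big_seq [RHS]big_seq; apply: eq_bigr => x ->.
  have st : \sum_(x <- s) (if x \in t then mass G x else 0) <=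
      \sum_(x <- s) mass G x.
    by apply: ler_sum => x _; case: ifP => // _; rewrite ltW ?mass_gt0.
  rewrite tE; apply: le_trans st; apply: ler_sum_support => // x.
    by case: ifP => // _; rewrite ltW ?mass_gt0.
  case: ifP => // xt; rewrite sE => /asboolP[].
  by split; [exact: tX|exact: gr].
have sc : \sum_(x <- s) mass G x * laplacian G g x <= (\sum_(x <- s) mass G x) * c.
  rewrite mulr_suml big_seq [leRHS]big_seq; apply: ler_sum => x /sX/gc xc.
  by apply: ler_wpM2l => //; rewrite ltW ?mass_gt0.
have Ds : - D <= \sum_(x <- s) mass G x * laplacian G g x.
  rewrite green_sum // lerNl -sumrN /D.
  have le_inner x : x \in s ->
      - (\sum_(y <- nbrs G x | y \notin s) weight G x y * (g y - g x)) <=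
      \sum_(k <- fset_set K) flux x k.
    move=> xs; rewrite -sumrN.
    apply: (@le_trans _ _ (\sum_(y <- nbrs G x)
        if y \in fset_set K then flux x y else 0)).
      rewrite big_mkcond big_seq [leRHS]big_seq; apply: ler_sum => y.
      rewrite mem_nbrs // => xy; rewrite (in_fset_set finK).
      case: ifPn => ys; last by case: ifP.
      have [Ky|nKy] := pselect (K y).
        rewrite mem_set // -mulrN; apply: ler_wpM2l; first exact: weight_ge0.
        by rewrite -normrN ler_norm.
      (* Off [K] and [s], the neighbour [y] lies in [X] above level [r], so [g] increases along this
         edge. *)
      rewrite memNset // oppr_le0 mulr_ge0 ?weight_ge0 // subr_ge0.
      move: (xs) ys; rewrite !sE => /asboolP[Xx gxr] /asboolP ys.
      case: (cut_cover cutK y) => // [Xy|Yy].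
        by apply: le_trans gxr _; rewrite leNgt; apply/negP => /ltW ?; apply: ys.
      by have := cut_edge cutK Xx Yy; rewrite xy.
    apply: le_trans (_ : _ <= \sum_(y <- fset_set K)
        if y \in fset_set K then flux x y else 0) _.
      apply: ler_sum_support; first exact: nbrs_uniq.
        by move=> y; case: ifP.
      by move=> y /negbTE ->.
    by rewrite big_seq [leRHS]big_seq; apply: ler_sum => y ->.
  apply: (@le_trans _ _ (\sum_(x <- s) \sum_(k <- fset_set K) flux x k)).
    by rewrite big_seq [leRHS]big_seq; exact: ler_sum.
  rewrite exchange_big /=; apply: ler_sum => k _; apply: ler_sum_support => // x.
  by move=> /weight_off_nbrs; rewrite /flux weight_sym => -> //; rewrite mul0r.
rewrite mulrN lerNl; apply: le_trans Ds (le_trans sc _).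
by rewrite ler_wnM2r // ltW.
Qed.

Lemma extremal_laplacian_le X Y K g c x : extremal G X Y K g ->
  (forall k, K k -> laplacian G g k = c) -> X x -> laplacian G g x <= c.
Proof.
move=> [gL gX _] gc /gX[k Kk gxk]; rewrite -(gc k Kk).
by apply: curvature => //; rewrite dist_sym.
Qed.

(** A negative constant would make the mass of [X] finite; a positive one, after a change of sign
    that swaps the sides, that of [Y]. *)
Lemma harmonic_on_core X Y K : salami_cut X Y K ->
  exists2 g, extremal G X Y K g & forall x, K x -> laplacian G g x = 0.
Proof.
move=> sK; have [cutK Xoo Yoo] := sK.
have [g [c [gE gc]]] := constant_laplacian hG cutK (salami_cut_nonempty sK).
exists g => // x Kx; rewrite gc //.
have [c0|c0|//] := ltgtP c 0; exfalso.
- apply: (negative_laplacian_mass cutK gE c0 _ Xoo) => y.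
  exact: extremal_laplacian_le gE gc.
- have gN := extremalN gE.
  apply: (negative_laplacian_mass (c := - c) (cut_swap cutK) gN _ _ Yoo); first lra.
  by move=> y; apply: (extremal_laplacian_le gN) => k /gc; rewrite laplacianN // => ->.
Qed.

End Mass.

(** * Connected cores, global harmonicity and uniqueness *)

Section Harmonic.
Context {R : realType} {V : countType} (G : weighted_graph R V).
Implicit Types (x y z k : V) (f g h u : V -> R) (A B F K X Y : set V).

Lemma component_refl A x : component G A x x.
Proof. by exists [::]. Qed.

Lemma component_cons A x y z :
  adj G x z -> A z -> component G A z y -> component G A x y.
Proof.
move=> xz Az [p [zp lst] pA]; exists (z :: p); first by split=> //=; rewrite xz.
by move=> w; rewrite inE => /orP[/eqP->|/pA].
Qed.

Lemma component_rcons A x y z :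
  component G A x y -> adj G y z -> A z -> component G A x z.
Proof.
move=> [p [xp lst] pA] yz Az; exists (rcons p z).
  by split; rewrite ?rcons_path ?last_rcons // xp lst.
by move=> w; rewrite mem_rcons inE => /orP[/eqP->|/pA].
Qed.

Lemma component_trans A x y z :
  component G A x y -> component G A y z -> component G A x z.
Proof.
move=> [p [xp <-] pA] [q [yq lst] qA]; exists (p ++ q).
  by split; rewrite ?cat_path ?last_cat // xp.
by move=> w; rewrite mem_cat => /orP[/pA|/qA].
Qed.

Lemma component_sub A B x y : A `<=` B -> component G A x y -> component G B x y.
Proof. by move=> AB [p xpy pA]; exists p => // z /pA/AB. Qed.

Lemma component_ind A x (P : V -> Prop) :
  P x -> (forall y z, A z -> adj G y z -> P y -> P z) ->
  forall y, component G A x y -> P y.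
Proof.
move=> Px PS y [p [xp <-] pA]; elim: p x Px xp pA => [//|z p IH] x Px /=.
move=> /andP[xz zp] pA; apply: IH => //.
  by apply: PS xz Px; apply: pA; exact: mem_head.
by move=> w wp; apply: pA; rewrite inE wp orbT.
Qed.

(** A walk is tested on its vertices after the start only, whereas the reversed walk ends at [x];
    hence the hypothesis [A x]. *)
Lemma component_sym A x y : A x -> component G A x y -> component G A y x.
Proof.
move=> Ax xy; suff [] : component G A y x /\ A y by [].
apply: (component_ind (P := fun z => component G A z x /\ A z) _ _ xy).
  by split=> //; exact: component_refl.
move=> w z Az wz [wx Aw]; split=> //.
by apply: component_cons wx => //; rewrite adj_sym.
Qed.

Definition connected_in A := forall x y, A x -> A y -> component G A x y.

Lemma connected_in_center A c : A c -> (forall x, A x -> component G A c x) ->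
  connected_in A.
Proof.
move=> Ac cA x y Ax Ay; apply: component_trans (cA y Ay).
exact: component_sym (cA x Ax).
Qed.

(** To [c], add one walk inside [A] from [c] to each point of [F]. *)
Lemma connected_hull A F c : connected_in A -> finite_set F -> F `<=` A -> A c ->
  exists B, [/\ finite_set B, F `<=` B, B `<=` A, B c & connected_in B].
Proof.
move=> Aconn /finite_seqP[s ->] sA Ac.
suff [B [finB sB BA Bc cB]] : exists B, [/\ finite_set B, [set` s] `<=` B,
    B `<=` A, B c & forall x, B x -> component G B c x].
  by exists B; split=> //; exact: connected_in_center cB.
elim: s sA => [_|x s IH sA].
  exists [set c]; split=> //; first by move=> x ->.
  by move=> x ->; exact: component_refl.
have [|B [finB sB BA Bc cB]] := IH.
  by move=> y ys; apply: sA; rewrite /= inE ys orbT.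
have [p [cp px] pA] := Aconn c x Ac (sA x (mem_head _ _)).
exists (B `|` [set` p]); split.
- by rewrite finite_setU; split=> //; exact: finite_seq.
- move=> y /=; rewrite inE => /orP[/eqP->|/sB]; last by left.
  rewrite -px; case: p {cp px pA} => [|z p]; first by left.
  by right; rewrite /= mem_last.
- by move=> y [/BA//|/pA].
- by left.
- move=> y [/cB|yp]; first by apply: component_sub; left.
  case/path.splitP: yp cp pA {px} => p1 p2; rewrite cat_path => /andP[cp1 _] _.
  exists (rcons p1 y); first by split=> //; rewrite last_rcons.
  by move=> z zp1 /=; right; rewrite mem_cat zp1.
Qed.

Hypothesis hG : nonneg_curved G.

Lemma connected_inT : connected_in setT.
Proof.
by move=> x y _ _; have [p xpy] := nc_connected hG x y; exists p.
Qed.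

(** Stepping from a point of [X] towards a point of [K] along a geodesic, one stays in [X] until [K]
    is reached. *)
Lemma connected_side X Y K : cut G X Y K -> K !=set0 -> connected_in K ->
  connected_in (K `|` X).
Proof.
move=> cutK [c Kc] Kconn.
apply: (connected_in_center (c := c)); first by left.
move=> x; elim/(dist_ind hG (o := c)): x => x IH [Kx|Xx].
  by apply: component_sub (Kconn c x Kc Kx); left.
have [->|/eqP nxc] := eqVneq x c; first exact: component_refl.
have [z [xz _ zc]] := dist_step hG nxc.
have KXz : (K `|` X) z.
  case: (cut_cover cutK z) => [Xz|Yz|Kz]; [by right| |by left].
  by have := cut_edge cutK Xx Yz; rewrite xz.
by apply: component_rcons (IH z zc KXz) _ _; [rewrite adj_sym|right].
Qed.

Lemma min_propagation A u a x : A a -> (forall z, u a <= u z) ->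
  (forall z, A z -> laplacian G u z <= 0) -> component G A a x ->
  u x = u a /\ laplacian G u x = 0.
Proof.
move=> Aa umin lap0 ax.
have minP z : A z -> u z = u a ->
    laplacian G u z = 0 /\ forall y, adj G z y -> u y = u z.
  by move=> Az uz; apply: laplacian_min => //; [move=> y _; rewrite uz|exact: lap0].
suff [Ax ux] : A x /\ u x = u a by split=> //; case: (minP x).
apply: (component_ind (P := fun z => A z /\ u z = u a) _ _ ax) => [//|y z].
move=> Az yz [Ay uy]; split=> //.
by have [_ /(_ z yz) ->] := minP y Ay uy.
Qed.

(* [B] is a finite connected core containing [x] inside [K `|` X], and [h] is its
   extremal function: [g - h] is superharmonic on [B] and attains its minimum over
   [V] in [B], so it is constant there. *)
Lemma harmonic_side X Y K g : salami_cut G X Y K -> extremal G X Y K g ->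
  (forall k, K k -> laplacian G g k = 0) -> connected_in (K `|` X) ->
  forall x, X x -> laplacian G g x = 0.
Proof.
move=> sK gE gK KXconn x Xx; have [cutK _ _] := sK.
have [B [finB KxB BKX Bx Bconn]] : exists B, [/\ finite_set B,
    K `|` [set x] `<=` B, B `<=` K `|` X, B x & connected_in B].
  apply: connected_hull => //; last by right.
  - by rewrite finite_setU; split; [exact: cut_finite cutK|exact: finite_set1].
  - by move=> y [Ky|->]; [left|right].
have KB : K `<=` B by move=> y Ky; apply: KxB; left.
have sB := salami_cutD sK finB KB.
have [h hE hB] := harmonic_on_core hG sB.
have gEB : extremal G (X `\` B) (Y `\` B) B g.
  by apply: extremal_sub gE => // z [].
have [a Ba amin] := finite_argmin (fun z => g z - h z) finB (ex_intro _ x Bx).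
have umin z : g a - h a <= g z - h z.
  have [y By] := extremal_compare z (salami_cutP sB) gEB hE.
  exact: le_trans (amin y By).
have lapB z : B z -> laplacian G (fun y => g y - h y) z <= 0.
  move=> Bz; rewrite laplacianB // hB // subr0.
  case: (BKX z Bz) => [/gK->//|Xz].
  exact: (extremal_laplacian_le hG gE gK).
have [_] := min_propagation Ba umin lapB (Bconn a x Ba Bx).
by rewrite laplacianB // (hB x Bx) subr0.
Qed.

(** Connectedness is asked of [K] together with [X], not of [K], because the shifted core of
    [descending_neighbour] need not be connected. *)
Lemma harmonic_extremal X Y K : salami_cut G X Y K -> connected_in (K `|` X) ->
  exists2 g, harmonic_function G g & extremal G X Y K g.
Proof.
move=> sK KXconn; have [cutK _ _] := sK.
have [c Kc] := salami_cut_nonempty hG sK.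
have [g gE gK] := harmonic_on_core hG sK.
exists g => //.
have gX := harmonic_side sK gE gK KXconn.
(* Once [g] is harmonic on [X], the core can be replaced by a connected one inside [K] and [X]; then
   the other side is connected together with its core, and the same argument applies to [-g]. *)
have [B [finB KB BKX Bc Bconn]] : exists B, [/\ finite_set B,
    K `<=` B, B `<=` K `|` X, B c & connected_in B].
  by apply: (connected_hull KXconn (cut_finite cutK)); [move=> k|]; left.
have sB := salami_cutD sK finB KB.
have gB z : B z -> laplacian G g z = 0 by move=> /BKX[/gK|/gX].
have gNE : extremal G (Y `\` B) (X `\` B) B (fun z => - g z).
  by apply: extremalN; apply: extremal_sub gE => // z [].
have BYconn : connected_in (B `|` (Y `\` B)).
  apply: connected_side Bconn; last by exists c.
  exact/cut_swap/(salami_cutP sB).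
have gY := harmonic_side (salami_cut_swap sB) gNE _ BYconn.
have {}gY z : (Y `\` B) z -> laplacian G g z = 0.
  move=> /gY; rewrite laplacianN // => gz.
  by apply/eqP; rewrite -oppr_eq0 gz // => k Bk; rewrite laplacianN // gB // oppr0.
move=> x; have [/gB//|nBx] := pselect (B x).
by case: (cut_cover cutK x) => [/gX//|Yx|/gK//]; exact: gY.
Qed.

(** Outside a finite set every point lies in [X1] or in [Y2], and either gives a comparison with a
    core. So [g1 - g2] attains its minimum and, being harmonic, is constant. Using the minimum alone
    explains why only [Y1] and [X2] must have finite overlap. *)
Lemma harmonic_extremal_unique X1 Y1 K1 g1 X2 Y2 K2 g2 :
  cut G X1 Y1 K1 -> extremal G X1 Y1 K1 g1 -> harmonic_function G g1 ->
  cut G X2 Y2 K2 -> extremal G X2 Y2 K2 g2 -> harmonic_function G g2 ->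
  finite_set (Y1 `&` X2) -> K1 !=set0 ->
  forall x y, g1 x - g2 x = g1 y - g2 y.
Proof.
move=> cut1 E1 H1 cut2 E2 H2 finYX [c K1c].
have [L1 _ _] := E1; have [L2 _ _] := E2.
pose K := K1 `|` K2 `|` (Y1 `&` X2).
have finK : finite_set K.
  rewrite !finite_setU; split=> //.
  by split; [exact: cut_finite cut1|exact: cut_finite cut2].
have [a Ka amin] := finite_argmin (fun z => g1 z - g2 z) finK
  (ex_intro _ c (or_introl (or_introl K1c))).
have umin z : g1 a - g2 a <= g1 z - g2 z.
  have [Kz|nKz] := pselect (K z); first exact: amin.
  have [X1z|nX1z] := pselect (X1 z).
    have [y K1y] := extremal_compare_upper E1 L2 X1z.
    by apply: le_trans (amin y _); left; left.
  have Y2z : Y2 z.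
    case: (cut_cover cut1 z) => [//|Y1z|K1z]; last by case: nKz; left; left.
    case: (cut_cover cut2 z) => [X2z|//|K2z]; first by case: nKz; right.
    by case: nKz; left; right.
  have [y K2y] := extremal_compare_lower L1 E2 Y2z.
  by apply: le_trans (amin y _); left; right.
have lap0 z : setT z -> laplacian G (fun w => g1 w - g2 w) z <= 0.
  by rewrite laplacianB // H1 H2 subrr.
have const z : g1 z - g2 z = g1 a - g2 a.
  have az : component G setT a z by exact: connected_inT.
  by have [] := min_propagation (I : setT a) umin lap0 az.
by move=> x y; rewrite !const.
Qed.

(* Whether [x] lies in the core, in [X] or in [Y] is immaterial: by uniqueness
   [g] is also extremal for a cut whose [X]-side contains [x]. *)
Lemma descending_neighbour X Y K g x : salami_cut G X Y K ->
  extremal G X Y K g -> harmonic_function G g ->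
  exists2 y, adj G x y & g x - g y = dist G x y.
Proof.
move=> sK gE gH; have [cutK Xoo Yoo] := sK.
have [B [finB KxB _ Bx Bconn]] : exists B, [/\ finite_set B,
    K `|` [set x] `<=` B, B `<=` setT, B x & connected_in B].
  apply: (connected_hull connected_inT) => //.
  by rewrite finite_setU; split; [exact: cut_finite cutK|exact: finite_set1].
have KB : K `<=` B by move=> y Ky; apply: KxB; left.
(* The new side is [X] together with [B], hence contains [x]. Its outer boundary [K2] only has
   neighbours of [B], since any edge from [X] to outside [X] ends in [K], which is part of [B]. *)
pose X2 := B `|` (X `\` B).
pose K2 := [set y | ~ X2 y /\ exists2 z, B z & adj G z y].
pose Y2 := [set y | ~ X2 y /\ ~ K2 y].
have XX2 : X `<=` X2.
  by move=> y Xy; have [By|nBy] := pselect (B y); [left|right].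
have X2conn : connected_in X2.
  apply: connected_side Bconn; last by exists x.
  exact: (salami_cutP (salami_cutD sK finB KB)).
have finK2 : finite_set K2.
  apply: (@sub_finite_set _ _ (\bigcup_(z in B) [set y | adj G z y])).
    by move=> y [_ [z Bz zy]]; exists z.
  by apply: bigcup_finite => // z _; exact: (nc_locally_finite hG).
have cut2 : cut G X2 Y2 K2.
  split=> //.
  - move=> y; have [X2y|nX2y] := pselect (X2 y); first by constructor 1.
    by have [K2y|nK2y] := pselect (K2 y); [constructor 3|constructor 2].
  - by move=> y X2y [].
  - move=> y z X2y [nX2z nK2z]; apply/negP => yz.
    case: X2y => [By|[Xy _]]; first by apply: nK2z; split=> //; exists y.
    case: (cut_cover cutK z) => [/XX2//|Yz|/KB Bz]; last by apply: nX2z; left.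
    by have := cut_edge cutK Xy Yz; rewrite yz.
have s2 : salami_cut G X2 Y2 K2.
  split=> //; first exact: set_mass_subpinfty Xoo.
  have finBK2 : finite_set (B `|` K2) by rewrite finite_setU.
  apply: set_mass_subpinfty (set_massD finBK2 Yoo) => y [Yy nBK2].
  split; last by move=> K2y; apply: nBK2; right.
  move=> [By|[Xy _]]; first by apply: nBK2; left.
  exact: (cut_disj cutK Xy).
have KX2conn : connected_in (K2 `|` X2).
  have X2x : X2 x by left.
  apply: (connected_in_center (c := x)); first by right.
  have xX2 y : X2 y -> component G (K2 `|` X2) x y.
    by move=> X2y; apply: component_sub (X2conn x y X2x X2y); right.
  move=> y [K2y|/xX2//]; have [_ [z Bz zy]] := K2y.
  by apply: component_rcons (xX2 z _) zy _; left.
have [g2 g2H g2E] := harmonic_extremal s2 KX2conn.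
have fin12 : finite_set (Y `&` X2).
  apply: sub_finite_set finB => y [Yy [//|[Xy _]]].
  by have := cut_disj cutK Xy Yy.
have diff := harmonic_extremal_unique cutK gE gH cut2 g2E g2H fin12
  (salami_cut_nonempty hG sK).
have [g2L g2X _] := g2E.
(* Now [g2] descends at full slope from [x] to [K2], hence already along the first edge of a
   geodesic, and [g] differs from [g2] by a constant. *)
have [y [nX2y _] gxy] : exists2 y, K2 y & g2 x - g2 y = dist G x y.
  by apply: g2X; left.
have nxy : x <> y by move=> xy; apply: nX2y; rewrite -xy; left.
have [z [xz xzy _]] := dist_step hG nxy.
exists z => //; have := diff x z.
have := g2L z x; have := g2L y z.
rewrite (dist_sym G z x) (dist_sym G y z); lra.
Qed.

End Harmonic.

(** * Gradient, flatness, recurrence and the number of ends *)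

Section Conclusions.
Context {R : realType} {V : countType} (G : weighted_graph R V).
Implicit Types (x y z k : V) (f g h u : V -> R) (A B C F K P Q X Y : set V).
Hypothesis hG : nonneg_curved G.

Lemma ascending_neighbour X Y K g x : salami_cut G X Y K ->
  extremal G X Y K g -> harmonic_function G g ->
  exists2 y, adj G x y & g y - g x = dist G x y.
Proof.
move=> sK gE gH.
have NH : harmonic_function G (fun z => - g z).
  by move=> z; rewrite laplacianN // gH oppr0.
have [y xy gxy] :=
  descending_neighbour hG x (salami_cut_swap sK) (extremalN gE) NH.
by exists y => //; lra.
Qed.

Lemma grad_plus1 g x : Lip1 G g ->
  (exists2 y, adj G x y & g y - g x = dist G x y) -> grad_plus G g x = 1%E.
Proof.
move=> gL [y xy gxy]; apply/le_anti/andP; split.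
  apply: ge_ereal_sup => _ [z zx <-]; rewrite lee_fin ler_pdivrMr ?mul1r //.
  by apply: dist_gt0; apply: nesym; exact: adj_neq zx.
apply: ereal_sup_ubound; exists y; first by rewrite /= adj_sym.
by rewrite gxy divff // gt_eqF // dist_gt0 //; exact: adj_neq xy.
Qed.

Lemma grad_minus1 g x : Lip1 G g ->
  (exists2 y, adj G x y & g x - g y = dist G x y) -> grad_minus G g x = 1%E.
Proof.
move=> gL [y xy gxy]; apply/le_anti/andP; split.
  apply: ge_ereal_sup => _ [z zx <-]; rewrite lee_fin ler_pdivrMr ?mul1r //.
    by rewrite (dist_sym G x).
  by apply: dist_gt0; apply: nesym; exact: adj_neq zx.
apply: ereal_sup_ubound; exists y; first by rewrite /= adj_sym.
by rewrite gxy divff // gt_eqF // dist_gt0 //; exact: adj_neq xy.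
Qed.

(** For an ascending neighbour [y], [g] itself competes in the infimum defining [kappa G x y] and
    gives the value 0. *)
Lemma flat_of_harmonic g : Lip1 G g -> harmonic_function G g ->
  (forall x, exists2 y, adj G x y & g y - g x = dist G x y) -> flat G.
Proof.
move=> gL gH gup x; apply/le_anti/andP; split; last first.
  apply: le_ereal_inf_tmp => _ [y yx <-]; apply: (nc_nonneg_ollivier hG).
  by rewrite adj_sym.
have [y xy gxy] := gup x.
apply: (@le_trans _ _ (kappa G x y)).
  by apply: ereal_inf_lbound; exists y => //=; rewrite adj_sym.
apply: mule_ge0_le0; first by rewrite lee_fin invr_ge0 dist_ge0.
by apply: ereal_inf_lbound; exists g; rewrite ?gH ?subrr.
Qed.

(* The test function [(1 - |g|/r)^+] is [1/r]-Lipschitz in [g] and, off a finite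
   set independent of [r], subharmonic wherever it is positive. *)
Lemma recurrent_of_harmonic X Y K g : cut G X Y K -> K !=set0 ->
  extremal G X Y K g -> harmonic_function G g -> recurrent G.
Proof.
move=> cutK [c Kc] + + eps eps0.
wlog gc : g / g c = 0 => [hwlog gE gH|gE gH].
  apply: (hwlog (fun z => g z + - g c)); first exact: subrr.
    exact: extremalDc.
  by move=> z; rewrite laplacianDc.
have finK := cut_finite cutK.
have sub0 r : finite_set (K `|` [set x | X x /\ g x <= r] `|`
    [set x | Y x /\ - g x <= r]).
  rewrite !finite_setU; split; first split=> //.
    exact: (extremal_sublevel_finite hG r finK gE).
  exact: (extremal_sublevel_finite hG r finK (extremalN gE)).
(* Off [F], [g] is positive on [X] and negative on [Y]; off [Z] the sign is the same at [x] and all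
   its neighbours. *)
pose F := K `|` [set x | X x /\ g x <= 0] `|` [set x | Y x /\ - g x <= 0].
have finF : finite_set F := sub0 0.
pose Z := F `|` \bigcup_(k in F) [set y | adj G k y].
have finZ : finite_set Z.
  rewrite finite_setU; split=> //; apply: bigcup_finite => // k _.
  exact: (nc_locally_finite hG).
pose D := \sum_(x <- fset_set Z) \sum_(y <- nbrs G x) weight G x y * `|g y - g x|.
have flux_ge0 x : 0 <= \sum_(y <- nbrs G x) weight G x y * `|g y - g x|.
  by apply: sumr_ge0 => y _; rewrite mulr_ge0 ?weight_ge0.
have D0 : 0 <= D by apply: sumr_ge0 => x _; exact: flux_ge0.
(* Chosen so that [D / r < eps]; the summand 1 keeps [r] positive when [D = 0]. *)
pose r := D / eps + 1.
have r0 : 0 < r by rewrite ltr_pwDr // divr_ge0 // ltW.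
have Dr : D / r < eps.
  by rewrite ltr_pdivrMr // /r mulrDr mulr1 mulrCA divff ?gt_eqF // mulr1 ltrDl.
pose f x := Num.max 0 (1 - `|g x| / r).
have f0 x : 0 <= f x by rewrite /f le_max lexx.
have f1 x : f x <= 1.
  by rewrite /f ge_max ler01 /= gerBl divr_ge0 // ltW.
have fge x : 1 - `|g x| / r <= f x by rewrite /f le_max lexx orbT.
have fE x : f x <> 0 -> f x = 1 - `|g x| / r /\ `|g x| <= r.
  rewrite /f; have [le0 //|gt0 _] := leP (1 - `|g x| / r) 0; split=> //.
  by move: gt0; rewrite subr_gt0 ltr_pdivrMr // mul1r => /ltW.
have fLip x y : f x - f y <= `|g y - g x| / r.
  have : `|g y| <= `|g y - g x| + `|g x|.
    by rewrite -{1}(subrK (g x) (g y)) ler_normD.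
  have ir0 : 0 <= r^-1 by rewrite invr_ge0 ltW.
  move=> /(ler_wpM2r ir0); rewrite mulrDl => gyx.
  have := fge y; have : 0 <= `|g y - g x| / r by rewrite mulr_ge0.
  have := f0 y; have [->|->] : f x = 0 \/ f x = 1 - `|g x| / r; try lra.
  by rewrite /f; have [_|_] := leP (1 - `|g x| / r) 0; [left|right].
have finf : finite_set [set x | f x != 0].
  apply: sub_finite_set (sub0 r) => x /eqP /fE[_].
  rewrite ler_norml => /andP[gl gr].
  case: (cut_cover cutK x) => [Xx|Yx|Kx]; [by left; right| |by left; left].
  by right; split=> //; rewrite lerNl.
exists f; split=> //.
- apply/le_anti/andP; split.
    by apply: ge_ereal_sup => _ [x _ <-]; rewrite lee_fin ger0_norm.
  apply: ereal_sup_ubound; exists c => //; congr EFin.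
  by rewrite /f gc normr0 mul0r subr0 (max_idPr _) ?ler01 // normr1.
rewrite /inner (fsbigTE (fset_set [set x | f x != 0])); last first.
  move=> x; rewrite in_fset_set // notin_setE /= => /negP; rewrite negbK => /eqP ->.
  by rewrite !mul0r.
apply: le_lt_trans Dr; rewrite -sumrN.
pose t x := if x \in fset_set Z then
  (\sum_(y <- nbrs G x) weight G x y * `|g y - g x|) / r else 0.
have t0 x : 0 <= t x by rewrite /t; case: ifP => // _; rewrite divr_ge0 // ltW.
apply: (@le_trans _ _ (\sum_(x <- fset_set [set x | f x != 0]) t x)).
  apply: ler_sum => x _.
  have -> : - (f x * laplacian G f x * mass G x) =
      f x * - (mass G x * laplacian G f x) by lra.
  rewrite /t in_fset_set //; have [Zx|nZx] := pselect (Z x).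
    rewrite mem_set //; have le_flux : - (mass G x * laplacian G f x) <=
        (\sum_(y <- nbrs G x) weight G x y * `|g y - g x|) / r.
      rewrite mass_laplacian // -sumrN mulr_suml; apply: ler_sum => y _.
      rewrite -mulrN -mulrA; apply: ler_wpM2l; rewrite ?weight_ge0 //.
      by rewrite opprB.
    apply: le_trans (ler_wpM2l (f0 x) le_flux) _.
    by rewrite ler_piMl // divr_ge0 // ltW.
  rewrite memNset //.
  have [->|/eqP/fE[fx _]] := eqVneq (f x) 0; first by rewrite mul0r.
  rewrite mulrN oppr_le0 mulr_ge0 // mulr_ge0 ?(ltW (mass_gt0 _ _)) //.
  have nF y : y = x \/ adj G x y -> ~ F y.
    move=> yx Fy; apply: nZx; case: yx => [<-|xy]; first by left.
    by right; exists y => //=; rewrite adj_sym.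
  have [sgn gsgn] : exists sgn : R, forall y, y = x \/ adj G x y ->
      `|g y| = sgn * g y.
    case: (cut_cover cutK x) => [Xx|Yx|Kx]; last first.
    - by case: (nF x (or_introl erefl)); left; left.
    - exists (-1) => y yx; have nFy := nF y yx.
      have Yy : Y y.
        case: yx => [->//|xy]; case: (cut_cover cutK y) => [Xy|//|Ky].
          by have := cut_edge cutK Xy Yx; rewrite adj_sym xy.
        by case: nFy; left; left.
      rewrite mulN1r ler0_norm // leNgt; apply/negP => gy.
      by apply: nFy; right; split=> //; rewrite oppr_le0 ltW.
    - exists 1 => y yx; have nFy := nF y yx.
      have Xy : X y.
        case: yx => [->//|xy]; case: (cut_cover cutK y) => [//|Yy|Ky].
          by have := cut_edge cutK Xx Yy; rewrite xy.
        by case: nFy; left; left.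
      rewrite mul1r ger0_norm // leNgt; apply/negP => gy.
      by apply: nFy; left; right; split=> //; rewrite ltW.
  (* Where [f] is positive it equals [1 - sgn * g / r], and it is at least this at the neighbours;
     comparison with this harmonic function shows that [f] is subharmonic at [x]. *)
  have <- : laplacian G (fun z => (- sgn / r) * g z + 0 * g z) x = 0.
    by rewrite laplacian_lin // gH !mulr0 addr0.
  apply: ler_laplacian => // y xy; rewrite fx (gsgn x (or_introl erefl)).
  by have := fge y; rewrite (gsgn y (or_intror xy)); lra.
apply: (@le_trans _ _ (\sum_(x <- fset_set Z) t x)).
  apply: ler_sum_support => //.
  by move=> x; rewrite /t => /negbTE ->.
rewrite /D mulr_suml big_seq [leRHS]big_seq; apply: ler_sum => x xZ.
by rewrite /t xZ.
Qed.

(** With [Q] on the upper side [g1] is large far out in [Q], with [Q] on the lower side [g2] is very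
    negative there; yet uniqueness makes [g1 - g2] constant, so [Q] stays near the core and is
    finite. *)
Lemma no_third_side P Q Y K : cut G (P `|` Q) Y K -> (forall x, P x -> ~ Q x) ->
  (forall x y, P x -> Q y -> ~~ adj G x y) ->
  set_mass G P = +oo%E -> infinite_set Q -> set_mass G Y = +oo%E -> False.
Proof.
move=> cut1 PQ edge Poo Qinf Yoo.
have s1 : salami_cut G (P `|` Q) Y K.
  by split=> //; apply: set_mass_subpinfty Poo; left.
have cut2 : cut G P (Q `|` Y) K.
  split=> [x|x Px [/(PQ x Px)//|Yx]| |x y Px [|Yy]].
  - case: (cut_cover cut1 x) => [[Px|Qx]|Yx|Kx].
    + by constructor 1.
    + by constructor 2; left.
    + by constructor 2; right.
    + by constructor 3.
  - by apply: (cut_disj cut1 _ Yx); left.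
  - exact: cut_finite cut1.
  - exact: edge.
  - by apply: (cut_edge cut1) => //; left.
have s2 : salami_cut G P (Q `|` Y) K.
  by split=> //; apply: set_mass_subpinfty Yoo; right.
have [c Kc] := salami_cut_nonempty hG s1.
have [B [finB KB _ Bc Bconn]] : exists B, [/\ finite_set B,
    K `<=` B, B `<=` setT, B c & connected_in G B].
  exact: (connected_hull (connected_inT hG) (cut_finite cut1)).
have B0 : B !=set0 by exists c.
have sB1 := salami_cutD s1 finB KB; have sB2 := salami_cutD s2 finB KB.
have [g1 H1 E1] := harmonic_extremal hG sB1
  (connected_side hG (salami_cutP sB1) B0 Bconn).
have [g2 H2 E2] := harmonic_extremal hG sB2
  (connected_side hG (salami_cutP sB2) B0 Bconn).
have fin12 : finite_set ((Y `\` B) `&` (P `\` B)).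
  rewrite (_ : _ `&` _ = set0); first exact: finite_set0.
  rewrite -subset0 => x [[Yx _] [Px _]].
  by apply: (cut_disj cut1 _ Yx); left.
have diff := harmonic_extremal_unique hG (salami_cutP sB1) E1 H1
  (salami_cutP sB2) E2 H2 fin12 B0.
have [_ g1X _] := E1; have [_ _ g2Y] := E2.
apply: Qinf; apply: (@sub_finite_set _ _ (B `|` \bigcup_(y in B) \bigcup_(z in B)
    [set x | dist G y x <= g1 c - g2 c - g1 y + g2 z])).
  move=> x Qx; have [Bx|nBx] := pselect (B x); [by left|right].
  have [y By gy] : exists2 y, B y & g1 x - g1 y = dist G x y.
    by apply: g1X; split=> //; right.
  have [z Bz gz] : exists2 z, B z & g2 z - g2 x = dist G x z.
    by apply: g2Y; split=> //; left.
  exists y => //; exists z => //=.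
  have := diff x c; have := dist_ge0 G x z; rewrite (dist_sym G y x).
  lra.
rewrite finite_setU; split=> //.
apply: bigcup_finite => // y _; apply: bigcup_finite => // z _.
exact: (nc_finite_balls hG).
Qed.

(** An infinite set may have finite mass, but one of the two pieces of [X] has infinite mass; it
    plays the part of [P] and the other that of [Q]. *)
Lemma no_infinite_splitting X Y K C : salami_cut G X Y K ->
  (forall x y, X x -> X y -> C x -> ~ C y -> ~~ adj G x y) ->
  infinite_set (X `&` C) -> ~ infinite_set (X `\` C).
Proof.
move=> [cutK Xoo Yoo] edge infC infNC.
have XE : X = (X `&` C) `|` (X `\` C) by rewrite setUIDK.
have Xoo' := Xoo; rewrite XE in Xoo'.
have [massC|massNC] := set_massU Xoo'.
- apply: (no_third_side (P := X `&` C) (Q := X `\` C)) massC infNC Yoo.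
  + by rewrite -XE; exact: cutK.
  + by move=> x [_ Cx] [_].
  + by move=> x y [Xx Cx] [Xy nCy]; exact: edge.
- apply: (no_third_side (P := X `\` C) (Q := X `&` C)) massNC infC Yoo.
  + by rewrite setUC -XE; exact: cutK.
  + by move=> x [_ nCx] [_].
  + by move=> x y [Xx nCx] [Xy Cy]; rewrite adj_sym; exact: edge.
Qed.

Lemma component_eq A x y z : A x -> A y -> component G A x z ->
  component G A y z -> component G A x = component G A y.
Proof.
move=> Ax Ay xz yz.
have xy : component G A x y := component_trans xz (component_sym Ay yz).
apply/seteqP; split=> w; apply: component_trans; last exact: xy.
exact: component_sym.
Qed.

(** Each of three infinite components meets a side in an infinite set, so two of them share a side,
    which the first of the two splits. *)
Lemma not_at_least_3_ends X Y K : salami_cut G X Y K -> ~ at_least_ends G 3.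
Proof.
move=> sK [K0 finK0 /pcard_leP/injfunPex[E ES Einj]].
pose F := K `|` K0.
have finF : finite_set F.
  by rewrite finite_setU; split=> //; exact: cut_finite (salami_cutP sK).
have sF : salami_cut G (X `\` F) (Y `\` F) F.
  by apply: salami_cutD sK finF _; left.
have EP i : (i < 3)%N -> exists2 x, ~ K0 x & E i = component G (~` K0) x.
  by move=> i3; have [[x nK0x Ex] _] := ES i i3; exists x.
have Einf i : (i < 3)%N -> infinite_set (E i).
  by move=> i3; have [] := ES i i3.
have Edisj i j : (i < 3)%N -> (j < 3)%N -> i != j -> E i `&` E j = set0.
  move=> i3 j3 ij; rewrite -subset0 => z [].
  have [x nx Ei] := EP i i3; have [y ny Ej] := EP j j3.
  rewrite Ei Ej => xz yz; move/eqP: ij; apply.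
  by apply: Einj; rewrite ?inE // Ei Ej; exact: component_eq xz yz.
have Eedge i x y : (i < 3)%N -> ~ F y -> E i x -> ~ E i y -> ~~ adj G x y.
  move=> i3 nFy; have [z nz ->] := EP i i3 => zx nzy; apply/negP => xy; apply: nzy.
  by apply: component_rcons zx xy _ => K0y; apply: nFy; right.
have one_side X' Y' i j : salami_cut G (X' `\` F) (Y' `\` F) F ->
    (i < 3)%N -> (j < 3)%N -> i != j ->
    infinite_set ((X' `\` F) `&` E i) -> ~ infinite_set ((X' `\` F) `&` E j).
  move=> s' i3 j3 ij infi infj.
  apply: (no_infinite_splitting (C := E i) s' _ infi).
    by move=> x y _ [_ nFy]; exact: Eedge.
  apply: sub_infinite_set infj => x [Xx Ejx]; split=> // Eix.
  by have : (E i `&` E j) x by []; rewrite Edisj.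
have side i : (i < 3)%N -> infinite_set ((X `\` F) `&` E i) \/
    infinite_set ((Y `\` F) `&` E i).
  move=> i3; have [finX|infX] := pselect (finite_set ((X `\` F) `&` E i));
    last by left.
  right=> finY; apply: (Einf i i3).
  apply: (@sub_finite_set _ _ (((X `\` F) `&` E i) `|` ((Y `\` F) `&` E i) `|` F)).
    move=> x Ex; case: (cut_cover (salami_cutP sF) x) => [Xx|Yx|Fx]; last by right.
      by left; left.
    by left; right.
  by rewrite finite_setU; split=> //; rewrite finite_setU.
have sX := one_side X Y; have sY := one_side Y X.
have sF' := salami_cut_swap sF.
have [i0|i0] := side 0%N isT; have [i1|i1] := side 1%N isT;
  have [i2|i2] := side 2%N isT.
- exact: (sX 0%N 1%N).
- exact: (sX 0%N 1%N).
- exact: (sX 0%N 2%N).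
- exact: (sY 1%N 2%N).
- exact: (sX 1%N 2%N).
- exact: (sY 0%N 2%N).
- exact: (sY 0%N 1%N).
- exact: (sY 0%N 1%N).
Qed.

(** Each point of [X] is joined within [X] to one of the finitely many neighbours of [K], and [X] is
    infinite, so one of these neighbours has an infinite component. *)
Lemma infinite_component X Y K : salami_cut G X Y K -> X `&` K = set0 ->
  exists x, [/\ X x, infinite_set (component G (~` K) x) &
    component G (~` K) x `<=` X].
Proof.
move=> sK XK; have [cutK Xoo Yoo] := sK.
have [c Kc] := salami_cut_nonempty hG sK.
have nK x : X x -> (~` K) x by move=> Xx Kx; have : (X `&` K) x by []; rewrite XK.
have compX x : X x -> component G (~` K) x `<=` X.
  move=> Xx y; apply: component_ind => // z w nKw zw Xz.
  case: (cut_cover cutK w) => [//|Yw|//].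
  by have := cut_edge cutK Xz Yw; rewrite zw.
pose N := [set x | X x /\ exists2 k, K k & adj G k x].
have finN : finite_set N.
  apply: (@sub_finite_set _ _ (\bigcup_(k in K) [set y | adj G k y])).
    by move=> x [_ [k Kk kx]]; exists k.
  apply: bigcup_finite; first exact: cut_finite cutK.
  by move=> k _; exact: (nc_locally_finite hG).
have XN x : X x -> exists2 z, N z & component G (~` K) z x.
  elim/(dist_ind hG (o := c)): x => x IH Xx.
  have nxc : x <> c by move=> xc; apply: (nK x Xx); rewrite xc.
  have [z [xz _ zc]] := dist_step hG nxc.
  case: (cut_cover cutK z) => [Xz|Yz|Kz].
  - have [w Nw wz] := IH z zc Xz; exists w => //.
    by apply: component_rcons wz _ (nK x Xx); rewrite adj_sym.
  - by have := cut_edge cutK Xx Yz; rewrite xz.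
  - exists x; last exact: component_refl.
    by split=> //; exists z => //; rewrite adj_sym.
have [x [Nx infx]] : exists x, N x /\ infinite_set (component G (~` K) x).
  apply/not_existsP => noinf.
  apply: (@set_mass_finite _ _ G X) Xoo.
  apply: (@sub_finite_set _ _ (\bigcup_(x in N) component G (~` K) x)).
    by move=> x /XN[z Nz zx]; exists z.
  apply: bigcup_finite => // x Nx.
  by apply: contrapT => infx; apply: (noinf x).
by have [Xx _] := Nx; exists x; split=> //; exact: compX.
Qed.

Lemma at_least_2_ends X Y K : salami_cut G X Y K -> X `&` K = set0 ->
  Y `&` K = set0 -> at_least_ends G 2.
Proof.
move=> sK XK YK; exists K; first exact: cut_finite (salami_cutP sK).
have [x [Xx infx compx]] := infinite_component sK XK.
have [y [Yy infy compy]] := infinite_component (salami_cut_swap sK) YK.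
have nxy : component G (~` K) x <> component G (~` K) y.
  move=> xy; apply: (cut_disj (salami_cutP sK) Xx); apply: compy; rewrite -xy.
  exact: component_refl.
have nKx : (~` K) x by move=> Kx; have : (X `&` K) x by []; rewrite XK.
have nKy : (~` K) y by move=> Ky; have : (Y `&` K) y by []; rewrite YK.
apply/pcard_leP/injfunPex.
exists (fun i : nat => component G (~` K) (if i == 0%N then x else y)).
  by move=> i _ /=; case: eqP => _; split=> //; [exists x|exists y].
by move=> [|[|i]] [|[|j]]; rewrite !inE //= => _ _ /esym/nxy.
Qed.

End Conclusions.

Theorem theorem1p1 (R : realType) (V : countType) (G : weighted_graph R V)
    (hG : salami G) :
  [/\ exactly_ends G 2,
      flat G,
      recurrent G &
      exists f : V -> R,
        harmonic_function G f /\
        (forall x : V, grad_minus G f x = 1%E /\ grad_plus G f x = 1%E)].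
Proof.
have [Gconn Glf Gpm Gfb Gric [X [Y [K part]]]] := hG.
have cG : nonneg_curved G by [].
have sK := salami_partition_cut part.
have [c Kc] := salami_cut_nonempty cG sK.
(* A connected core makes core and side connected, as [harmonic_extremal] requires. *)
have [B [finB KB _ Bc Bconn]] : exists B, [/\ finite_set B,
    K `<=` B, B `<=` setT, B c & connected_in G B].
  by apply: (connected_hull (connected_inT cG)) => //; exact: salami_finite part.
have B0 : B !=set0 by exists c.
have sB := salami_cutD sK finB KB; have cutB := salami_cutP sB.
have [g gH gE] := harmonic_extremal cG sB (connected_side cG cutB B0 Bconn).
have [gL _ _] := gE.
have gup x := ascending_neighbour cG x sB gE gH.
split.
- split; last exact: not_at_least_3_ends sK.
  exact: at_least_2_ends sK (salami_disjXK part) (salami_disjYK part).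
- exact: (flat_of_harmonic cG gL gH gup).
- exact: (recurrent_of_harmonic cG cutB B0 gE gH).
- exists g; split=> // x; split; last exact: grad_plus1.
  by apply: grad_minus1 => //; exact: (descending_neighbour cG x sB gE gH).
Qed.
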